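(* Let $R$ be a commutative Noetherian ring, $S$ a module-finite $R$-algebra, and $M$ and $N$ finitely generated right $S$-modules. Let $X:=j\text{-}\operatorname{Spec}(R)\cap\operatorname{Supp}_R(N)$, and suppose that $\dim(X)<\infty$. Then \[\operatorname{spl}_S(M,N)\geqslant\inf\{\operatorname{spl}_{S_{\mathfrak p}}(M_{\mathfrak p},N_{\mathfrak p})-\dim_X(\mathfrak p):\mathfrak p\in X\}.\]
   Context: Every ring has a $1$ and every module is unital; $S$ need not be commutative. A module-finite $R$-algebra is an $R$-algebra that is finitely generated as an $R$-module; right $S$-modules are viewed as $R$-modules in the natural way, and for $\mathfrak p\in\operatorname{Spec}(R)$, $M_{\mathfrak p}$, $N_{\mathfrak p}$, $S_{\mathfrak p}$ denote localizations at $R-\mathfrak p$. For an algebra $S$ over a commutative ring and right $S$-modules $M,N$, $\operatorname{spl}_S(M,N)$ denotes the supremum (possibly $\infty$) of the nonnegative integers $t$ such that there exists a split surjective $S$-linear map from $M$ to $N^{\oplus t}$ (i.e. a surjection having an $S$-linear right inverse). $j\text{-}\operatorname{Spec}(R)$ is the set of all $\mathfrak p\in\operatorname{Spec}(R)$ that can be expressed as an intersection of maximal ideals of $R$. $\operatorname{Supp}_R(N)=\{\mathfrak p\in\operatorname{Spec}(R):N_{\mathfrak p}\neq0\}$. Every subset of $\operatorname{Spec}(R)$ carries the subspace topology induced by the Zariski topology, and $\dim$ of such a subset is its Krull dimension as a topological space, with $\dim(\varnothing)=-\infty$. For $\mathfrak p\in X\subseteq\operatorname{Spec}(R)$, $\dim_X(\mathfrak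 p)$ is the Krull dimension of $\operatorname{Var}(\mathfrak p)\cap X$, where $\operatorname{Var}(\mathfrak p)=\{\mathfrak q\in\operatorname{Spec}(R):\mathfrak p\subseteq\mathfrak q\}$. The infimum of the empty set is $\infty$. *)

(* Defs.v *)
From HB Require Import structures.
From mathcomp Require Import all_boot all_order all_algebra.
From mathcomp Require Import all_classical all_reals.
From mathcomp Require Import topology zify ring.

Set Implicit Arguments.
Unset Strict Implicit.
Unset Printing Implicit Defensive.

Import Order.TTheory GRing.Theory Num.Theory.

Local Open Scope classical_set_scope.
Local Open Scope ring_scope.
Local Open Scope quotient_scope.

Section Ideals.
Context (R : comPzRingType).
Implicit Types I J : set R.

Definition is_ideal I :=
  [/\ I 0, forall x y, I x -> I y -> I (x + y) & forall a x, I x -> I (a * x)].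

Definition is_prime_ideal I :=
  [/\ is_ideal I, ~ I 1 & forall x y, I (x * y) -> I x \/ I y].

Definition is_maximal_ideal I :=
  [/\ is_ideal I, ~ I 1 &
      forall J, is_ideal J -> I `<=` J -> J = I \/ J = setT].

Definition noetherian :=
  forall I, is_ideal I ->
    exists n (g : 'I_n -> R), I = [set \sum_i c i * g i | c in @setT ('I_n -> R)].

Record spec := Spec { prime_set :> set R; prime_setP : is_prime_ideal prime_set }.

HB.instance Definition _ := gen_eqMixin spec.
HB.instance Definition _ := gen_choiceMixin spec.

Definition Var (E : set R) : set spec := [set p : spec | E `<=` p].

Definition zariski_open (U : set spec) := exists E, U = ~` Var E.

Lemma zariski_openT : zariski_open setT.
Proof.
exists [set 1]; apply/seteqP; split=> p // _ /= h.
by case: (prime_setP p) => _ + _; apply; apply: h.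
Qed.

Lemma zariski_openI : setI_closed zariski_open.
Proof.
move=> _ _ [E ->] [F ->].
exists [set z | exists x y, [/\ E x, F y & z = x * y]].
rewrite -setCU; congr (~` _); apply/seteqP; split=> p /=.
  have [[_ _ pM] _ _] := prime_setP p.
  move=> [h|h] _ [x [y [Ex Fy ->]]]; last exact/pM/h.
  by rewrite mulrC; exact/pM/h.
move=> h; apply: contrapT => /not_orP[].
move=> /existsNP[x /not_implyP[Ex px]] /existsNP[y /not_implyP[Fy py]].
have [_ _ /(_ x y)] := prime_setP p.
by case=> //; apply: h; exists x, y.
Qed.

Lemma zariski_open_bigU (I : Type) (f : I -> set spec) :
  (forall i, zariski_open (f i)) -> zariski_open (\bigcup_i f i).
Proof.
move=> h; have [E fE] := choice h.
exists (\bigcup_i E i); apply/seteqP; split=> p /=.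
  move=> [i _]; rewrite fE => hp hq; apply: hp => x Ex.
  by apply: hq; exists i.
move=> hp; apply: contrapT => hq; apply: hp => x [i _ Ex].
apply: contrapT => px; apply: hq; exists i => //.
by rewrite fE => /(_ x Ex).
Qed.

HB.instance Definition _ := isOpenTopological.Build spec
  zariski_openT zariski_openI zariski_open_bigU.

Definition j_spec : set spec :=
  [set p : spec | exists F : set (set R),
     (forall I, F I -> is_maximal_ideal I) /\ (p : set R) = \bigcap_(I in F) I].

End Ideals.

Arguments j_spec : clear implicits.

Section KrullDimension.
Context (T : topologicalType).

Definition irreducible (Z : set T) :=
  Z !=set0 /\ forall A B, closed A -> closed B ->
    Z `<=` A `|` B -> Z `<=` A \/ Z `<=` B.

Definition irreducible_chain (n : nat) (Z : nat -> set T) :=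
  (forall i, (i <= n)%N -> closed (Z i) /\ irreducible (Z i)) /\
  (forall i, (i < n)%N -> Z i `<` Z i.+1).

Definition krull_dim : \bar int :=
  supremum -oo%E [set n%:Z%:E | n in [set n | exists Z, irreducible_chain n Z]].

End KrullDimension.

(** Suprema and infima of extended integers always exist, so that [supremum]
    and [infimum] never take their default value on a nonempty set. *)
Lemma ereal_int_supremums_neq0 (A : set (\bar int)) : supremums A !=set0.
Proof.
have [Aoo|Aoo] := pselect (A +oo%E).
  by exists +oo%E; split=> [x _|x /(_ _ Aoo)//]; exact: leey.
have [[x Ax]|nA] := pselect (exists x : int, A x%:E); last first.
  exists -oo%E; split=> [[x||] // Ax|x _]; last exact: leNye.
  by case: nA; exists x.
have [[b ubA]|nub] := pselect (exists b : int, ubound A b%:E); last first.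
  exists +oo%E; split=> [y _|[b|//|] ubA]; first exact: leey.
    by case: nub; exists b.
  by have := ubA _ Ax.
have [n] : exists n : nat, b <= x + n%:Z.
  by exists `|b - x|%N; rewrite -lerBlDl; lia.
elim: n x Ax => [|n ih] x Ax bx.
  exists x%:E; split=> [y Ay|y]; last exact.
  by apply: le_trans (ubA _ Ay) _; rewrite lee_fin; lia.
have [[y Ay xy]|nx] := pselect (exists2 y : int, A y%:E & x < y).
  by apply: (ih y Ay); lia.
exists x%:E; split=> [[y||] Ay|y]; [|by []|exact: leNye|exact].
by rewrite lee_fin leNgt; apply/negP => xy; apply: nx; exists y.
Qed.

Lemma ereal_int_infimums_neq0 (A : set (\bar int)) : infimums A !=set0.
Proof.
have [s [ub lub]] := ereal_int_supremums_neq0 (-%E @` A).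
exists (- s)%E; split=> [x Ax|x lbx].
  by rewrite leeNl; apply: ub; exists x.
by rewrite leeNr; apply: lub => _ [y Ay <-]; rewrite leeN2; exact: lbx.
Qed.

(** The library's [lalgType] and [algType] exclude the zero ring, which has to
    be allowed here: [S], and a fortiori a localization of [S], may vanish. *)
Record algebra (R : comPzRingType) := Algebra {
  alg_ring :> pzRingType;
  alg_map : {rmorphism R -> alg_ring};
  alg_mapC : forall r s, alg_map r * s = s * alg_map r }.

Definition fin_gen (A : pzRingType) (V : lmodType A) :=
  exists n (g : 'I_n -> V), forall v, exists c : 'I_n -> A, v = \sum_i c i *: g i.

Definition split_surjective (A : pzRingType) (U V : lmodType A)
    (f : {linear U -> V}) :=
  set_surj setT setT f /\ exists g : {linear V -> U}, cancel g f.

(** Right [S]-modules are encoded as left modules over the converse ring [S^c],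
    here and below. *)
Definition spl (S : pzRingType) (U V : lmodType S^c) : \bar int :=
  supremum 0%E [set t%:Z%:E | t in
    [set t : nat | exists f : {linear U -> {ffun 'I_t -> V}}, split_surjective f]].

Arguments spl : clear implicits.

Section Localization.
Context (R : comPzRingType) (p : spec R).

Record denom := Denom { dval :> R; denomP : ~ prime_set p dval }.

HB.instance Definition _ := gen_eqMixin denom.
HB.instance Definition _ := gen_choiceMixin denom.

Lemma prime_set1 : ~ prime_set p 1.
Proof. by case: (prime_setP p). Qed.

Lemma prime_setM (s t : denom) : ~ prime_set p (dval s * dval t).
Proof. by have [_ _ pM] := prime_setP p => /pM[]; exact: denomP. Qed.

Definition denom1 : denom := Denom prime_set1.
Definition denomM (s t : denom) : denom := Denom (@prime_setM s t).

Section Fractions.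
Context (V : lmodType R).
Implicit Types (v w : V) (s t : denom).

Definition loc_equiv (x y : V * denom) :=
  `[< exists u : denom, dval u *: (dval y.2 *: x.1) = dval u *: (dval x.2 *: y.1) >].

Lemma loc_equiv_refl : reflexive loc_equiv.
Proof. by move=> x; apply/asboolP; exists denom1. Qed.

Lemma loc_equiv_sym : symmetric loc_equiv.
Proof. by move=> x y; apply/asboolP/asboolP => -[u e]; exists u. Qed.

Lemma loc_equiv_trans : transitive loc_equiv.
Proof.
move=> [w t] [v s] [x r] /asboolP[/= a e] /asboolP[/= b f].
apply/asboolP; exists (denomM (denomM a b) t) => /=.
transitivity ((dval b * dval r) *: (dval a *: (dval t *: v))).
  by rewrite !scalerA; congr (_ *: _); ring.
rewrite e; transitivity ((dval a * dval s) *: (dval b *: (dval r *: w))).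
  by rewrite !scalerA; congr (_ *: _); ring.
by rewrite f !scalerA; congr (_ *: _); ring.
Qed.

Canonical loc_equiv_equiv :=
  EquivRel loc_equiv loc_equiv_refl loc_equiv_sym loc_equiv_trans.

Definition loc := {eq_quot loc_equiv}.
HB.instance Definition _ : EqQuotient _ loc_equiv loc := EqQuotient.on loc.
HB.instance Definition _ := Choice.on loc.

Definition frac v s : loc := \pi_loc (v, s).

Lemma frac_eq v s w t : frac v s = frac w t <->
  exists u : denom, dval u *: (dval t *: v) = dval u *: (dval s *: w).
Proof.
split=> [/eqP|h]; first by rewrite /frac eqmodE => /asboolP.
by apply/eqP; rewrite /frac eqmodE; apply/asboolP.
Qed.

Lemma frac_repr (x : loc) : x = frac (repr x).1 (repr x).2.
Proof. by rewrite /frac -surjective_pairing reprK. Qed.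

Lemma loc_ind (P : loc -> Prop) : (forall v s, P (frac v s)) -> forall x, P x.
Proof. by move=> h x; rewrite [x]frac_repr. Qed.

Definition loc_zero : loc := frac 0 denom1.

Definition loc_opp (x : loc) : loc := frac (- (repr x).1) (repr x).2.

Definition loc_add (x y : loc) : loc :=
  frac (dval (repr y).2 *: (repr x).1 + dval (repr x).2 *: (repr y).1)
       (denomM (repr x).2 (repr y).2).

Lemma loc_oppE v s : loc_opp (frac v s) = frac (- v) s.
Proof.
have /frac_eq[u e] := esym (frac_repr (frac v s)).
by apply/frac_eq; exists u; rewrite !scalerN e.
Qed.

Lemma loc_addE v s w t :
  loc_add (frac v s) (frac w t) = frac (dval t *: v + dval s *: w) (denomM s t).
Proof.
have /frac_eq[a e] := esym (frac_repr (frac v s)).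
have /frac_eq[b f] := esym (frac_repr (frac w t)).
rewrite /loc_add; set x := repr (frac v s) in e *.
set y := repr (frac w t) in f *.
apply/frac_eq; exists (denomM a b) => /=; rewrite !scalerDr; congr (_ + _).
  transitivity ((dval b * dval t * dval y.2) *: (dval a *: (dval s *: x.1))).
    by rewrite !scalerA; congr (_ *: _); ring.
  by rewrite e !scalerA; congr (_ *: _); ring.
transitivity ((dval a * dval s * dval x.2) *: (dval b *: (dval t *: y.1))).
  by rewrite !scalerA; congr (_ *: _); ring.
by rewrite f !scalerA; congr (_ *: _); ring.
Qed.

Lemma loc_addA : associative loc_add.
Proof.
elim/loc_ind=> v s; elim/loc_ind=> w t; elim/loc_ind=> x r.
rewrite !loc_addE; apply/frac_eq; exists denom1 => /=.
by rewrite !scalerDr !scalerA addrA; congr (_ *: _ + _ *: _ + _ *: _); ring.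
Qed.

Lemma loc_addC : commutative loc_add.
Proof.
elim/loc_ind=> v s; elim/loc_ind=> w t.
rewrite !loc_addE; apply/frac_eq; exists denom1 => /=.
by rewrite addrC [dval t * _]mulrC.
Qed.

Lemma loc_add0 : left_id loc_zero loc_add.
Proof.
elim/loc_ind=> v s; rewrite !loc_addE scaler0 add0r scale1r.
by apply/frac_eq; exists denom1; rewrite /= mul1r.
Qed.

Lemma loc_addN : left_inverse loc_zero loc_opp loc_add.
Proof.
elim/loc_ind=> v s; rewrite loc_oppE loc_addE scalerN addNr.
by apply/frac_eq; exists denom1; rewrite /= !scaler0.
Qed.

HB.instance Definition _ := GRing.isZmodule.Build loc
  loc_addA loc_addC loc_add0 loc_addN.

Lemma fracD v s w t :
  frac v s + frac w t = frac (dval t *: v + dval s *: w) (denomM s t).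
Proof. exact: loc_addE. Qed.

Lemma frac0 s : frac 0 s = 0.
Proof. by apply/frac_eq; exists denom1; rewrite !scaler0. Qed.

Lemma frac_cancel v s t : frac (dval t *: v) (denomM t s) = frac v s.
Proof.
apply/frac_eq; exists denom1; rewrite /= !scalerA; congr (_ *: _); ring.
Qed.

Lemma fracDr v w s : frac v s + frac w s = frac (v + w) s.
Proof. by rewrite fracD -scalerDr frac_cancel. Qed.

End Fractions.

(** The map (v / s, w / t) |-> f v w / (s * t) induced by a bilinear f. *)
Section Bilinear.
Context (U V W : lmodType R) (f : U -> V -> W).

Definition loc_map2 (x : loc U) (y : loc V) : loc W :=
  frac (f (repr x).1 (repr y).1) (denomM (repr x).2 (repr y).2).

Hypothesis fDl : forall u u' v, f (u + u') v = f u v + f u' v.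
Hypothesis fDr : forall u v v', f u (v + v') = f u v + f u v'.
Hypothesis fZl : forall a u v, f (a *: u) v = a *: f u v.
Hypothesis fZr : forall a u v, f u (a *: v) = a *: f u v.

Lemma loc_map2E u s v t :
  loc_map2 (frac u s) (frac v t) = frac (f u v) (denomM s t).
Proof.
have /frac_eq[a e] := esym (frac_repr (frac u s)).
have /frac_eq[b g] := esym (frac_repr (frac v t)).
rewrite /loc_map2; set x := repr (frac u s) in e *.
set y := repr (frac v t) in g *.
apply/frac_eq; exists (denomM a b) => /=.
transitivity (f (dval a *: (dval s *: x.1)) (dval b *: (dval t *: y.1))).
  by rewrite !fZl !fZr !scalerA; congr (_ *: _); ring.
by rewrite e g !fZl !fZr !scalerA; congr (_ *: _); ring.
Qed.

Lemma loc_map2Dl x x' y : loc_map2 (x + x') y = loc_map2 x y + loc_map2 x' y.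
Proof.
elim/loc_ind: x => u s; elim/loc_ind: x' => u' s'; elim/loc_ind: y => v t.
rewrite fracD !loc_map2E fDl !fZl fracD.
apply/frac_eq; exists denom1 => /=.
by rewrite !scalerDr !scalerA; congr (_ *: _ + _ *: _); ring.
Qed.

Lemma loc_map2Dr x y y' : loc_map2 x (y + y') = loc_map2 x y + loc_map2 x y'.
Proof.
elim/loc_ind: x => u s; elim/loc_ind: y => v t; elim/loc_ind: y' => v' t'.
rewrite fracD !loc_map2E fDr !fZr fracD.
apply/frac_eq; exists denom1 => /=.
by rewrite !scalerDr !scalerA; congr (_ *: _ + _ *: _); ring.
Qed.

End Bilinear.
End Localization.

Section Restriction.
Context (R : comPzRingType) (S : algebra R).

Definition algmod : Type := S.
HB.instance Definition _ := GRing.Zmodule.on algmod.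

Definition algmod_scale (r : R) (x : algmod) : algmod := alg_map S r * (x : S).

Lemma algmod_scaleA a b x :
  algmod_scale a (algmod_scale b x) = algmod_scale (a * b) x.
Proof. by rewrite /algmod_scale rmorphM mulrA. Qed.

Lemma algmod_scale1 : left_id 1 algmod_scale.
Proof. by move=> x; rewrite /algmod_scale rmorph1 mul1r. Qed.

Lemma algmod_scaleDr : right_distributive algmod_scale +%R.
Proof. by move=> a x y; rewrite /algmod_scale mulrDr. Qed.

Lemma algmod_scaleDl x : {morph algmod_scale^~ x : a b / a + b}.
Proof. by move=> a b; rewrite /algmod_scale rmorphD mulrDl. Qed.

HB.instance Definition _ := GRing.Zmodule_isLmodule.Build R algmod
  algmod_scaleA algmod_scale1 algmod_scaleDr algmod_scaleDl.

Definition restr (M : lmodType S^c) : Type := M.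

Section RestrictionModule.
Context (M : lmodType S^c).

HB.instance Definition _ := GRing.Zmodule.on (restr M).

Definition restr_scale (r : R) (x : restr M) : restr M :=
  (alg_map S r : S^c) *: (x : M).

Lemma restr_scaleA a b x :
  restr_scale a (restr_scale b x) = restr_scale (a * b) x.
Proof. by rewrite /restr_scale scalerA mulrC rmorphM. Qed.

Lemma restr_scale1 : left_id 1 restr_scale.
Proof. by move=> x; rewrite /restr_scale rmorph1; exact: scale1r. Qed.

Lemma restr_scaleDr : right_distributive restr_scale +%R.
Proof. by move=> a x y; exact: scalerDr. Qed.

Lemma restr_scaleDl x : {morph restr_scale^~ x : a b / a + b}.
Proof. by move=> a b; rewrite /restr_scale rmorphD; exact: scalerDl. Qed.

HB.instance Definition _ := GRing.Zmodule_isLmodule.Build R (restr M)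
  restr_scaleA restr_scale1 restr_scaleDr restr_scaleDl.

End RestrictionModule.
End Restriction.

Section LocalizedAlgebra.
Context (R : comPzRingType) (S : algebra R) (p : spec R).

Definition loc_alg : Type := loc p (algmod S).
HB.instance Definition _ := GRing.Zmodule.on loc_alg.

Definition algmod_mul (x y : algmod S) : algmod S := (x : S) * (y : S).

Definition alg_frac (x : S) s : loc_alg := @frac _ p (algmod S) x s.

Definition loc_alg_one : loc_alg := alg_frac 1 (denom1 p).
Definition loc_alg_mul : loc_alg -> loc_alg -> loc_alg := loc_map2 algmod_mul.

Lemma algmod_mulZl a x y : algmod_mul (a *: x) y = a *: algmod_mul x y.
Proof. exact/esym/mulrA. Qed.

Lemma algmod_mulZr a x y : algmod_mul x (a *: y) = a *: algmod_mul x y.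
Proof.
by rewrite /GRing.scale/= /algmod_scale /algmod_mul !mulrA alg_mapC.
Qed.

Lemma algmod_mulDl x y z :
  algmod_mul (x + y) z = algmod_mul x z + algmod_mul y z.
Proof. exact: mulrDl. Qed.

Lemma algmod_mulDr x y z :
  algmod_mul x (y + z) = algmod_mul x y + algmod_mul x z.
Proof. exact: mulrDr. Qed.

Lemma loc_alg_mulE (x y : S) s t :
  loc_alg_mul (alg_frac x s) (alg_frac y t) = alg_frac (x * y) (denomM s t).
Proof. exact: (loc_map2E algmod_mulZl algmod_mulZr). Qed.

Lemma alg_frac_ind (P : loc_alg -> Prop) :
  (forall x s, P (alg_frac x s)) -> forall x, P x.
Proof. by move=> h x; elim/(@loc_ind _ p (algmod S)): x. Qed.

Lemma alg_frac_eq (x y : S) s t :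
  x = y -> dval s = dval t -> alg_frac x s = alg_frac y t.
Proof. by move=> -> e; apply/frac_eq; exists (denom1 p); rewrite e. Qed.

Lemma loc_alg_mulA : associative loc_alg_mul.
Proof.
elim/alg_frac_ind=> x r; elim/alg_frac_ind=> y s; elim/alg_frac_ind=> z t.
by rewrite !loc_alg_mulE; apply: alg_frac_eq; rewrite /= mulrA.
Qed.

Lemma loc_alg_mul1 : left_id loc_alg_one loc_alg_mul.
Proof.
elim/alg_frac_ind=> x s; rewrite loc_alg_mulE.
by apply: alg_frac_eq; rewrite /= mul1r.
Qed.

Lemma loc_alg_1mul : right_id loc_alg_one loc_alg_mul.
Proof.
elim/alg_frac_ind=> x s; rewrite loc_alg_mulE.
by apply: alg_frac_eq; rewrite /= mulr1.
Qed.

Lemma loc_alg_mulDl : left_distributive loc_alg_mul +%R.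
Proof.
move=> x y z.
exact: (loc_map2Dl algmod_mulDl algmod_mulZl algmod_mulZr).
Qed.

Lemma loc_alg_mulDr : right_distributive loc_alg_mul +%R.
Proof.
move=> x y z.
exact: (loc_map2Dr algmod_mulDr algmod_mulZl algmod_mulZr).
Qed.

HB.instance Definition _ := GRing.Zmodule_isPzRing.Build loc_alg
  loc_alg_mulA loc_alg_mul1 loc_alg_1mul loc_alg_mulDl loc_alg_mulDr.

Lemma alg_fracM (x y : S) s t :
  alg_frac x s * alg_frac y t = alg_frac (x * y) (denomM s t).
Proof. exact: loc_alg_mulE. Qed.

End LocalizedAlgebra.

Section LocalizedModule.
Context (R : comPzRingType) (S : algebra R) (p : spec R) (M : lmodType S^c).

Definition loc_mod : Type := loc p (restr M).
HB.instance Definition _ := GRing.Zmodule.on loc_mod.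

Definition mod_frac (m : M) s : loc_mod := @frac _ p (restr M) m s.

(** [restr_act a m] is m a in right-module notation. *)
Definition restr_act (a : algmod S) (m : restr M) : restr M :=
  (a : S^c) *: (m : M).

Definition loc_mod_scale : (loc_alg S p)^c -> loc_mod -> loc_mod :=
  loc_map2 restr_act.

Lemma restr_actZl r a m : restr_act (r *: a) m = r *: restr_act a m.
Proof.
transitivity (((alg_map S r : S^c) * (a : S^c)) *: (m : M)); last first.
  by rewrite -scalerA.
by congr (_ *: (m : M)); exact: alg_mapC.
Qed.

Lemma restr_actZr r a m : restr_act a (r *: m) = r *: restr_act a m.
Proof.
transitivity (((alg_map S r : S^c) * (a : S^c)) *: (m : M)); last first.
  by rewrite -scalerA.
transitivity (((a : S^c) * (alg_map S r : S^c)) *: (m : M)).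
  by rewrite -scalerA.
by congr (_ *: (m : M)); exact: alg_mapC.
Qed.

Lemma restr_actDl a b m : restr_act (a + b) m = restr_act a m + restr_act b m.
Proof. exact: (@scalerDl S^c M). Qed.

Lemma restr_actDr a m n : restr_act a (m + n) = restr_act a m + restr_act a n.
Proof. exact: (@scalerDr S^c M). Qed.

Lemma loc_mod_scaleE (a : S) s (m : M) t :
  loc_mod_scale (alg_frac a s) (mod_frac m t) =
  mod_frac ((a : S^c) *: m) (denomM s t).
Proof. exact: (loc_map2E restr_actZl restr_actZr). Qed.

Lemma mod_frac_ind (P : loc_mod -> Prop) :
  (forall m s, P (mod_frac m s)) -> forall x, P x.
Proof. by move=> h x; elim/(@loc_ind _ p (restr M)): x. Qed.

Lemma mod_frac_eq (m n : M) s t :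
  m = n -> dval s = dval t -> mod_frac m s = mod_frac n t.
Proof. by move=> -> e; apply/frac_eq; exists (denom1 p); rewrite e. Qed.

Lemma loc_mod_scaleA (a b : (loc_alg S p)^c) x :
  loc_mod_scale a (loc_mod_scale b x) = loc_mod_scale (a * b) x.
Proof.
elim/alg_frac_ind: a => a r; elim/alg_frac_ind: b => b s.
elim/mod_frac_ind: x => m t.
rewrite [_ * _]alg_fracM !loc_mod_scaleE.
by apply: mod_frac_eq; rewrite ?scalerA //= mulrA [dval r * _]mulrC.
Qed.

Lemma loc_mod_scale1 : left_id 1 loc_mod_scale.
Proof.
elim/mod_frac_ind=> m t; rewrite loc_mod_scaleE.
by apply: mod_frac_eq; rewrite /= ?scale1r ?mul1r.
Qed.

Lemma loc_mod_scaleDr : right_distributive loc_mod_scale +%R.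
Proof.
move=> a x y; exact: (loc_map2Dr restr_actDr restr_actZl restr_actZr).
Qed.

Lemma loc_mod_scaleDl x : {morph loc_mod_scale^~ x : a b / a + b}.
Proof.
move=> a b; exact: (loc_map2Dl restr_actDl restr_actZl restr_actZr).
Qed.

HB.instance Definition _ := GRing.Zmodule_isLmodule.Build (loc_alg S p)^c loc_mod
  loc_mod_scaleA loc_mod_scale1 loc_mod_scaleDr loc_mod_scaleDl.

End LocalizedModule.

Section Support.
Context (R : comPzRingType).

Definition Supp (S : algebra R) (N : lmodType S^c) : set (spec R) :=
  [set p | exists x : loc_mod p N, x != 0].

(** The topology on [set_type X] is the one induced by that of [spec R]. *)
Definition dim_set (X : set (spec R)) : \bar int := krull_dim (set_type X).

Definition dim_at (X : set (spec R)) (p : spec R) : \bar int :=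
  dim_set (Var p `&` X).

End Support.

(* Main.v *)
(** Let [A = End_S(N)], a module-finite [R]-algebra, and let [phi] be the matrix
    over [A] of all composites [f_i \o g_j] of generators [f_i] of
    [Hom_S(M, N)] and [g_j] of [Hom_S(N, M)]. Clearing denominators, [M_p] maps
    split onto [N_p^s] iff [C * phi * G = d] for some matrices [C], [G] over
    [A] with [s] rows, resp. columns, and some scalar [d] outside [p]: say that
    [phi] has rank at least [s] at [p] ([rank_at] below). From rank at least
    [t + dim_X p] on [X] one has to find a matrix [T] with [t] rows such that
    [T * phi] has rank [t] on [X]; then [T * phi] is right invertible over [A]
    locally, hence globally.

    The rows of [phi] are removed one at a time (Serre, Bass, Eisenbud-Evans),
    after adding multiples of the removed row [y] to the remaining [u] rows.
    Removing a row lowers the rank by at most 1, so only the [p] with rank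
    exactly [t + dim_X p <= u] matter. Such a [p] is the generic point of a
    component of the closed set where the rank is at most [t + dim_X p], so
    there are finitely many of them. They are handled successively, minimal
    primes last, with multiples of [y] that vanish modulo the primes already
    treated.

    For a single [p], everything takes place in the localization of a matrix
    ring over [A], which is semilocal: modulo its radical it is semisimple,
    hence unit-regular, and unit-regularity gives both the stable range
    condition used to modify the rows and the estimate for the rank after
    removal of a row. *)

Require Import Defs.
From HB Require Import structures.
From mathcomp Require Import fingroup perm.
From mathcomp Require Import all_boot all_order all_algebra.
From mathcomp Require Import all_classical all_reals topology.
From mathcomp Require Import zify ring.

Set Implicit Arguments.
Unset Strict Implicit.
Unset Printing Implicit Defensive.

Import Order.TTheory GRing.Theory Num.Theory.

Local Open Scope classical_set_scope.
Local Open Scope ring_scope.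

(** * Unit-regularity of semisimple rings *)

Section UnitRegular.
Context (L : pzRingType).
Implicit Types (a b e f g h t u v x y : L).

Definition inverses u v := u * v = 1 /\ v * u = 1.

(** The right ideal eL is simple or zero. *)
Definition simple_idem e :=
  [/\ e * e = e & forall x, e * x != 0 -> exists y, e * x * y = e].

(** Schur's lemma for eLe. Simplicity gives only a right inverse [t]; inverting [t] in turn shows
    that it is two-sided. *)
Lemma simple_idem_inv e x : simple_idem e -> e * x = x -> x * e = x -> x != 0 ->
  exists t, [/\ t * x = e, x * t = e, e * t = t & t * e = t].
Proof.
move=> [ee simple].
have half z : e * z = z -> z * e = z -> z != 0 ->
    exists t, [/\ z * t = e, e * t = t & t * e = t].
  move=> ez ze z0; have [|s zs] := simple z; first by rewrite ez.
  exists (e * s * e); split; last by rewrite -mulrA ee.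
    by rewrite !mulrA ze -[z in z * s]ez zs ee.
  by rewrite !mulrA ee.
move=> ex xe x0; have [t [xt et te]] := half _ ex xe x0.
have t0 : t != 0.
  apply: contraNneq x0 => t0; move: xt; rewrite t0 mulr0 => e0.
  by rewrite -ex -e0 mul0r.
have [s [ts es se]] := half _ et te t0.
exists t; split=> //.
by rewrite -xe -{1}ts !mulrA -(mulrA t x t) xt te ts.
Qed.

(** The matrix of [x : eL -> fL] extended by the identity along the common
    complement [(1 - f)L] of [eL] and [fL]. *)
Lemma exchange_simple_half e f x y : simple_idem e ->
  f * x = x -> x * e = x -> e * y = y -> y * f = y -> y * x = e -> x * y = f ->
  f * e != 0 ->
  exists u v, [/\ inverses u v, u * e = x &
    forall h, e * h = 0 -> f * h = 0 -> u * h = h].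
Proof.
move=> se fx xe ey yf yx xy fe0.
have [ee _] := se.
have fe : f * e = x * (y * e) by rewrite mulrA xy.
have [] := simple_idem_inv (x := y * e) se.
- by rewrite mulrA ey.
- by rewrite -mulrA ee.
- by apply: contraNneq fe0 => h; rewrite fe h mulr0.
move=> t [tye yet et te].
have tyy : t * y * y = y by rewrite -{2}ey !mulrA -(mulrA t y e) tye ey.
have yty : y * t * y = y by rewrite -{1}et mulrA yet ey.
have fty : f * t * y = f by rewrite -et mulrA fe -!mulrA (mulrA y) (mulrA (y *
  e)) yet ey xy.
(* [w] projects onto eL along (1 - f)L, so that 1 - w + x w sends eL to fL through [x] and fixes (1
   - f)L. *)
set w := t * y.
have wv : w * (y + (1 - f)) = y.
  by rewrite !(mulrDr, mulrN) mulr1 tyy -[w * f]mulrA yf subrr addr0.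
have vx : (y + (1 - f)) * x = e.
  by rewrite !(mulrDl, mulNr) mul1r yx fx subrr addr0.
have vw : (y + (1 - f)) * w = y + (w - f).
  by rewrite !(mulrDl, mulNr) mul1r /w !mulrA yty fty.
have ew : e * w = w by rewrite mulrA et.
exists (1 - w + x * w), (y + (1 - f)); split.
- split.
    rewrite !mulrDl mulNr mul1r -mulrA wv xy.
    by rewrite [y + (1 - f)]addrC addrK subrK.
  rewrite !mulrDr mulrN mulr1 vw mulrA vx ew opprD opprB.
  by rewrite addrACA subrr add0r addrA !subrK.
- by rewrite mulrDl mulrBl mul1r -(mulrA x) -(mulrA t) tye xe subrr add0r.
- move=> h eh fh; have wh : w * h = 0 by rewrite -mulrA -yf -mulrA fh !mulr0.
  by rewrite mulrDl mulrBl mul1r -mulrA wh mulr0 subr0 addr0.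
Qed.

Lemma simple_idem_iso e f x y : simple_idem e ->
  f * x = x -> x * e = x -> e * y = y -> y * f = y -> y * x = e -> x * y = f ->
  simple_idem f.
Proof.
move=> [_ se] fx xe ey yf yx xy; split=> [|a fa];
  first by rewrite -{2}xy mulrA fx.
have [|b yb] := se (y * a).
  by apply: contraNneq fa => ya; rewrite -xy -mulrA -ey -[e * y * a]mulrA ya
    mulr0.
have yab : y * a * b = e by rewrite -yb !mulrA ey.
exists (b * y); transitivity (x * (y * a * b) * y); first by rewrite -xy !mulrA.
by rewrite yab xe.
Qed.

(** If f e or e f is nonzero, the previous case applies to [x] or to its inverse [y]. Otherwise [e]
    and [f] are orthogonal, and x + y + (1 - e - f) is an involution exchanging eL and fL. *)
Lemma exchange_simple e f x y : simple_idem e ->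
  f * x = x -> x * e = x -> e * y = y -> y * f = y -> y * x = e -> x * y = f ->
  exists u v, [/\ inverses u v, u * e = x &
    forall h, e * h = 0 -> f * h = 0 -> u * h = h].
Proof.
move=> se fx xe ey yf yx xy; have sf := simple_idem_iso se fx xe ey yf yx xy.
have [fe|] := eqVneq (f * e) 0; last exact: exchange_simple_half yx xy.
have [ef|ef0] := eqVneq (e * f) 0; last first.
  have [u [v [[uv vu] ufy uh]]] := exchange_simple_half sf ey yf fx xe xy yx
    ef0.
  exists v, u; split=> //; first by rewrite -yx -ufy -(mulrA u) fx mulrA vu
    mul1r.
  by move=> h eh fh; rewrite -{1}(uh h fh eh) mulrA vu mul1r.
have [ee _] := se; have [ff _] := sf.
have xx : x * x = 0 by rewrite -[LHS]/(x * x) -[X in X * _]xe -[X in _ * X]fx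
  mulrA -(mulrA x) ef mulr0 mul0r.
have yy : y * y = 0 by rewrite -[X in X * _]yf -[X in _ * X]ey mulrA -(mulrA y)
  fe mulr0 mul0r.
have ye : y * e = 0 by rewrite -yf -mulrA fe mulr0.
have xf : x * f = 0 by rewrite -xe -mulrA ef mulr0.
have ex : e * x = 0 by rewrite -fx mulrA ef mul0r.
have fy : f * y = 0 by rewrite -ey mulrA fe mul0r.
pose c := 1 - e - f; pose u := x + y + c.
have xc : x * c = 0 by rewrite /c !mulrBr mulr1 xe xf subrr subr0.
have yc : y * c = 0 by rewrite /c !mulrBr mulr1 ye yf subr0 subrr.
have ue : u * e = x by rewrite /u /c !(mulrDl,
  mulNr) mul1r xe ye ee fe subrr subr0 !addr0.
have uf : u * f = y.
  by rewrite /u /c !(mulrDl, mulNr) mul1r xf yf ef ff subr0 subrr add0r addr0.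
have uu : u * u = 1.
  rewrite {2}/u /c 2!mulrDr !mulrBr mulr1 ue uf.
  have -> : u * x = e by rewrite /u /c !(mulrDl,
    mulNr) mul1r xx yx ex fx subr0 subrr add0r addr0.
  have -> : u * y = f by rewrite /u /c !(mulrDl,
    mulNr) mul1r xy yy ey fy subrr subr0 !addr0.
  have -> : u - x - y = c by rewrite /u addrAC [x + y + c]addrC addrA addrK
    addrK.
  by rewrite /c addrC -[1 - e - f]addrA -opprD subrK.
exists u, u; split=> // h eh fh.
have xh : x * h = 0 by rewrite -xe -mulrA eh mulr0.
have yh : y * h = 0 by rewrite -yf -mulrA fh mulr0.
by rewrite /u /c !(mulrDl, mulNr) mul1r xh yh eh fh oppr0 !addr0 !add0r.
Qed.

Definition right_ideal (H : set L) :=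
  [/\ H 0, forall x y, H x -> H y -> H (x + y) & forall x a, H x -> H (x * a)].

Lemma right_idealB H x y : right_ideal H -> H x -> H y -> H (x - y).
Proof. by case=> _ HD HM Hx Hy; apply: HD => //; rewrite -mulrN1;
  exact: HM. Qed.

Lemma right_ideal_sum H (I : Type) (s : seq I) (P : pred I) (F : I -> L) :
  right_ideal H -> (forall i, P i -> H (F i)) -> H (\sum_(i <- s | P i) F i).
Proof. by case=> H0 HD _ HF; elim/big_ind: _. Qed.

Section Semisimple.
Context (r : nat) (e : 'I_r -> L).
Hypothesis e_simple : forall i, simple_idem (e i).
Hypothesis e_orth : forall i j, i != j -> e i * e j = 0.
Hypothesis e_sum : \sum_i e i = 1.
Implicit Types S : {set 'I_r}.

(** The direct sum of the e_i L with i in [S]. *)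
Let V S := [set x : L | forall i, i \notin S -> e i * x = 0].

Let V_ideal S : right_ideal (V S).
Proof.
split=> [i _|x y hx hy i iS|x a hx i iS]; first exact: mulr0.
- by rewrite mulrDr hx // hy // addr0.
- by rewrite mulrA hx // mul0r.
Qed.

Let e_expand x : x = \sum_i e i * x.
Proof. by rewrite -mulr_suml e_sum mul1r. Qed.

(** [S] is maximal such that V S meets [H] trivially. For [i] outside [S], enlarging [S] by [i]
    yields an [x] in [H] with e_i x nonzero, and simplicity puts e_i in H + V S. *)
Lemma complement H : right_ideal H -> exists S,
  (forall x, H x -> V S x -> x = 0) /\ exists h v, [/\ H h, V S v & 1 = h + v].
Proof.
move=> Hid; have [H0 HD HM] := Hid.
pose P S := `[< forall x, H x -> V S x -> x = 0 >].
have P0 : P finset.set0.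
  apply/asboolP => x _ Vx; rewrite [x]e_expand big1 // => i _.
  by apply: Vx; rewrite inE.
have [S /maxsetP[/asboolP PS maxS] _] := maxset_exists P0.
exists S; split=> //.
have VS := V_ideal S.
suff dec i : exists hv, [/\ H hv.1, V S hv.2 & e i = hv.1 + hv.2].
  have [hv hvP] := choice dec.
  exists (\sum_i (hv i).1), (\sum_i (hv i).2); split.
  - by apply: right_ideal_sum => // i _; case: (hvP i).
  - by apply: right_ideal_sum => // i _; case: (hvP i).
  - by rewrite -big_split -e_sum; apply: eq_bigr => i _; case: (hvP i).
have [iS|iS] := boolP (i \in S).
  exists (0, e i); split=> //=; last by rewrite add0r.
  by move=> j jS; apply: e_orth; apply: contraNneq jS => ->.
have : ~ forall x, H x -> V (i |: S)%SET x -> x = 0.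
  move=> /asboolP/maxS; rewrite finset.subsetUr => /(_ isT) eS.
  by move: iS; rewrite -eS finset.setU11.
move=> /existsNP[x] /not_implyP[Hx /not_implyP[Vx x0]].
have Vd : V S (x - e i * x).
  move=> j jS; rewrite mulrBr mulrA; have [-> | ji] := eqVneq j i.
    by have [-> _] := e_simple i; rewrite subrr.
  by rewrite e_orth // mul0r subr0 Vx // !inE negb_or ji.
have [_ /(_ x)[|y yE]] := e_simple i.
  apply/eqP => ix0; apply: x0; apply: PS => //.
  by move: Vd; rewrite ix0 subr0.
exists (x * y, - ((x - e i * x) * y)); split=> /=; first exact: HM.
  by rewrite -mulrN; case: VS => _ _; apply.
by rewrite mulrBl opprB yE addrC subrK.
Qed.

(** Left multiplication by [a] is injective on a complement V S of its kernel. A unit [u] agreeing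
    with [a] on V S is built one summand at a time; if [w] is the component of 1 in V S, then a = u
    w, and the inverse of [u] is the required unit. *)
Theorem unit_regular a : exists u v, inverses u v /\ a * u * a = a.
Proof.
have [] := @complement [set x | a * x = 0].
  split=> [|x y /= hx hy|x y /= hx]; first exact: mulr0.
    by rewrite mulrDr hx hy addr0.
  by rewrite mulrA hx mul0r.
move=> S [KV [k [w [/= ak Vw kw]]]].
have VS := V_ideal S; have [V0 VD VM] := VS.
(* A left inverse of [a] on V S, obtained by splitting 1 along a complement of a V S. *)
have [h hP] : exists h, forall x, V S x -> h * (a * x) = x.
  have aVid : right_ideal [set a * x | x in V S].
    split=> [|_ _ [x Vx <-] [y Vy <-]|_ b [x Vx <-]].
    - by exists 0; rewrite ?mulr0.
    - by exists (x + y); [exact: VD|rewrite mulrDr].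
    - by exists (x * b); [exact: VM|rewrite mulrA].
  have [S' [aVS [_ [nu [[h Vh <-] Vnu ahnu]]]]] := complement aVid.
  exists h => x Vx; apply/esym/eqP; rewrite -subr_eq0; apply/eqP.
  have Vd : V S (x - h * (a * x)) by apply: right_idealB Vx _ => //;
    exact: VM Vh.
  apply: KV => //=; apply: aVS; first by exists (x - h * (a * x)).
  have -> : a * (x - h * (a * x)) = nu * (a * x).
    rewrite mulrBr mulrA -{1}[a * x]mul1r ahnu mulrDl addrAC.
    by rewrite !mulrA subrr add0r.
  by have [_ _ VM'] := V_ideal S'; exact: VM'.
have ee i : e i * e i = e i by case: (e_simple i).
have Ve i : i \in S -> V S (e i).
  by move=> iS j jS; apply: e_orth; apply: contraNneq jS => ->.
have step (s : seq 'I_r) : uniq s -> {subset s <= S} ->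
    exists u v, inverses u v /\ forall i, i \in s -> u * e i = a * e i.
  elim: s => [_ _|i s IH /= /andP[iNs us] sS].
    by exists 1, 1; split=> //; split; rewrite mulr1.
  have [|u [v [[uv vu] uP]]] := IH us.
    by move=> j js; apply: sS; rewrite inE js orbT.
  have ne j : j \in s -> j != i by apply: contraTneq => ->.
  pose eps := \sum_(j <- s) e j.
  have ge : e i * eps = 0.
    rewrite mulr_sumr big_seq big1 // => j js.
    by rewrite e_orth // eq_sym ne.
  have eps_e j : j \in s -> eps * e j = e j.
    move=> js; rewrite mulr_suml (bigD1_seq j) //= ee big1 ?addr0 // => l lj.
    exact: e_orth.
  pose x := v * a * e i; pose y := e i * (h * u).
  have hva z : V S z -> h * u * (v * a * z) = z.
    by move=> Vz; rewrite !mulrA -(mulrA h) uv mulr1 -mulrA hP.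
  have yx : y * x = e i by rewrite /y -mulrA hva ?ee //; exact/Ve/sS/mem_head.
  have vae j : j \in s -> v * a * e j = e j.
    by move=> js; rewrite -mulrA -uP // mulrA vu mul1r.
  have ye j : j \in s -> y * e j = 0.
    move=> js; rewrite -[X in y * X]vae // /y -mulrA hva ?e_orth 1?eq_sym ?ne
      //.
    by apply/Ve/sS; rewrite inE js orbT.
  have yeps : y * eps = 0.
    by rewrite mulr_sumr big_seq big1 // => j js; exact: ye.
  have xg : x * e i = x by rewrite -mulrA ee.
  have gy : e i * y = y by rewrite mulrA ee.
  have xE : u * x = a * e i by rewrite /x !mulrA uv mul1r.
  clearbody x y.
  (* [x'] is [x] without its components along [s]; the unipotent 1 + n below carries [x'] back to
     [x] and fixes e_j for j in [s]. *)
  pose x' := x - eps * x.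
  have yx' : y * x' = e i by rewrite mulrBr mulrA yeps mul0r subr0.
  have x'g : x' * e i = x' by rewrite mulrBl xg -(mulrA eps) xg.
  have [u' [v' [[u'v' v'u'] u'g u'h]]] :
      exists u' v', [/\ inverses u' v', u' * e i = x' &
        forall z, e i * z = 0 -> x' * y * z = 0 -> u' * z = z].
    apply: (exchange_simple (e_simple i) _ x'g gy _ yx' erefl).
    - by rewrite -(mulrA x') yx'.
    - by rewrite mulrA yx' gy.
  pose n := eps * x * y.
  have nn : n * n = 0 by rewrite /n !mulrA -(mulrA (eps * x) y) yeps mulr0
    !mul0r.
  have nx' : (1 + n) * x' = x.
    by rewrite mulrDl mul1r -(mulrA (eps * x)) yx' -(mulrA eps) xg subrK.
  exists (u * (1 + n) * u'), (v' * (1 - n) * v); split; first split.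
  - have -> : u * (1 + n) * u' * (v' * (1 - n) * v) =
              u * ((1 + n) * (u' * v') * (1 - n)) * v by rewrite !mulrA.
    rewrite u'v' mulr1 mulrBr mulr1 mulrDl mul1r nn addr0 addrK mulr1 uv //.
  - have -> : v' * (1 - n) * v * (u * (1 + n) * u') =
              v' * ((1 - n) * (v * u) * (1 + n)) * u' by rewrite !mulrA.
    by rewrite vu mulr1 mulrDr mulr1 mulrBl mul1r nn subr0 subrK mulr1 v'u'.
  move=> j; rewrite inE => /predU1P[->|js].
    by rewrite -(mulrA (u * _)) u'g -(mulrA u) nx'.
  have ej : e i * e j = 0 by rewrite e_orth // eq_sym ne.
  rewrite -(mulrA (u * _)) u'h //; last by rewrite -(mulrA x') ye ?mulr0.
  by rewrite -(mulrA u) mulrDl mul1r /n -(mulrA (eps * x)) ye // mulr0 addr0 uP.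
have [|i|u [v [[uv vu] uP]]] := step (enum S); first exact: enum_uniq.
  by rewrite mem_enum.
have uV x : V S x -> u * x = a * x.
  move=> Vx; rewrite [x]e_expand !mulr_sumr; apply: eq_bigr => i _.
  have [iS|iS] := boolP (i \in S); last by rewrite Vx // !mulr0.
  by rewrite !mulrA uP // mem_enum.
have aw : a = u * w by rewrite uV // -[LHS]mulr1 kw mulrDr ak add0r.
exists v, u; split=> //.
rewrite {2}aw mulrA -(mulrA a) vu mulr1 -uV //.
Qed.

End Semisimple.
End UnitRegular.

(** * Stable range and cancellation in unit-regular rings *)

Section UnitRegularMatrices.
Context (L : pzRingType).
Hypothesis ureg : forall a : L, exists u v, inverses u v /\ a * u * a = a.
Implicit Types (a b e x y z : L).

Lemma unit_regular_dedekind x y : x * y = 1 -> y * x = 1.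
Proof.
move=> xy; have [u [v [[uv vu] yuy]]] := ureg y.
have uy : u * y = 1 by rewrite -[LHS]mul1r -xy -mulrA (mulrA y) yuy.
have yv : y = v by rewrite -[y]mul1r -vu -mulrA uy mulr1.
have xu : x = u by rewrite -[x]mulr1 -vu mulrA -yv xy mul1r.
by rewrite yv xu.
Qed.

(** With [w] a unit such that a w a = a and [w'] its inverse, z b = (w' - a)(1 - x a). Left
    multiplication by 1 + n cancels the term in x a, and w (a + l (w' - a)) = e + l (1 - e) has
    inverse e + m (1 - e). That [z] does not depend on [l] is what later allows multipliers taken
    from other primes. *)
Lemma unit_regular_stable_range a b x y : x * a + y * b = 1 ->
  exists z, forall l m, (forall t, l * t = t * l) -> (forall t,
    m * t = t * m) ->
    l * m = 1 -> exists v, v * (a + l * z * b) = 1.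
Proof.
move=> xayb; have [w [w' [[ww' w'w] awa]]] := ureg a.
exists ((1 - a * w) * w' * y) => l m lC mC lm.
pose f := a * w; pose e := w * a; have wa : w * a = e by [].
have ff : f * f = f by rewrite /f mulrA awa.
have fa : f * a = a by rewrite /f awa.
have ee : e * e = e by rewrite /e mulrA -(mulrA w) -mulrA awa.
have nf : (1 - f) * w' = w' - a.
  by rewrite mulrBl mul1r /f -mulrA ww' mulr1.
pose n := l * (w' - a) * x * f.
have f1 : f * (w' - a) = 0 by rewrite mulrBr fa /f -mulrA ww' mulr1 subrr.
have na : n * a = l * (w' - a) * x * a by rewrite /n -[LHS]mulrA fa.
exists ((e + m * (1 - e)) * w * (1 + n)).
have -> : a + l * ((1 - a * w) * w' * y) * b =
          a + l * (w' - a) - l * (w' - a) * x * a.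
  rewrite -/f nf -addrA; congr (_ + _).
  have yb : y * b = 1 - x * a by rewrite -xayb addrC addKr.
  by rewrite !mulrA -(mulrA _ y) yb (mulrBr (l * (w' - a))) mulr1 !mulrA.
clearbody f e.
have -> : (e + m * (1 - e)) * w * (1 + n) *
    (a + l * (w' - a) - l * (w' - a) * x * a) =
    (e + m * (1 - e)) * w * (a + l * (w' - a)).
  rewrite -(mulrA ((e + m * (1 - e)) * w)); congr (_ * _); rewrite mulrDl mul1r.
  have -> : n * (a + l * (w' - a) - l * (w' - a) * x * a) = n * a.
    have nl t : n * (l * (w' - a) * t) = 0.
      by rewrite /n !mulrA -(mulrA _ f l) -(lC f) mulrA -(mulrA _ f (w' - a))
        f1 mulr0 mul0r.
    rewrite (mulrBr n) (mulrDr n) -[l * (w' - a)]mulr1 nl addr0.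
    by rewrite mulr1 -(mulrA (l * _)) nl subr0.
  by rewrite na subrK.
have wz : w * (a + l * (w' - a)) = e + l * (1 - e).
  by rewrite mulrDr mulrA -(lC w) -mulrA mulrBr ww' wa.
have e1 : e * (1 - e) = 0 by rewrite mulrBr mulr1 ee subrr.
have e1' : (1 - e) * e = 0 by rewrite mulrBl mul1r ee subrr.
have e2 : (1 - e) * (1 - e) = 1 - e by rewrite mulrBr mulr1 e1' subr0.
rewrite -mulrA wz mulrDr !mulrDl ee -mulrA e1' mulr0 addr0 mulrA -lC -mulrA e1
  mulr0.
rewrite add0r !mulrA -(mulrA m) -(lC (1 - e)) !mulrA mC lm mul1r e2.
by rewrite addrC subrK.
Qed.

(** On the kernel of [y], [x] acts as the identity. This kernel is w (1 - q) L with q = y w, so the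
    inverse of [w] maps it onto (1 - q) L, which projects onto (1 - e) L because e q = q. *)
Lemma unit_regular_drop e c y x : e * e = e -> e * y = y -> x + c * y = 1 ->
  exists d z, (1 - e) * d * x * z = 1 - e.
Proof.
move=> ee ey xcy; have [w [w' [[ww' w'w] ywy]]] := ureg y.
pose q := y * w.
have qq : q * q = q by rewrite /q mulrA ywy.
have eq : e * q = q by rewrite /q mulrA ey.
have yw : y * w = q by [].
clearbody q.
pose z := w * (1 - q) * (1 - e).
have yz : y * z = 0.
  by rewrite /z !mulrA yw (mulrBr q) mulr1 qq subrr mul0r.
exists w', z.
have -> : x = 1 - c * y by rewrite -xcy addrK.
have xz : (1 - c * y) * z = z by rewrite mulrBl mul1r -mulrA yz mulr0 subr0.
rewrite -mulrA xz /z -(mulrA (1 - e)) 2!(mulrA w') w'w mul1r (mulrBl (1 - e))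
  mul1r mulrBr.
have -> : (1 - e) * (1 - e) = 1 - e.
  by rewrite mulrBr mulr1 mulrBl mul1r ee subrr subr0.
by rewrite mulrA mulrBl mul1r eq subrr mul0r subr0.
Qed.
End UnitRegularMatrices.

(** * Quotients of semilocal rings *)

Section QuotientRing.
Local Open Scope quotient_scope.
Context (L : pzRingType).

Record two_sided_ideal := TwoSidedIdeal {
  ideal_set :> L -> Prop;
  ideal_right : right_ideal ideal_set;
  ideal_left : forall a x, ideal_set x -> ideal_set (a * x) }.

Context (J : two_sided_ideal).
Implicit Types x y z : L.

Definition quo_equiv x y := `[< J (x - y) >].

Let JD x y : J x -> J y -> J (x + y).
Proof. by case: (ideal_right J) => _ + _; apply. Qed.

Let JN x : J x -> J (- x).
Proof. by move=> Jx; rewrite -mulN1r; exact: ideal_left. Qed.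

Let JMr x a : J x -> J (x * a).
Proof. by case: (ideal_right J) => _ _; apply. Qed.

Lemma quo_equiv_refl : reflexive quo_equiv.
Proof. by move=> x; apply/asboolP; rewrite subrr; case: (ideal_right J). Qed.

Lemma quo_equiv_sym : symmetric quo_equiv.
Proof. by move=> x y; apply/asboolP/asboolP => /JN; rewrite opprB. Qed.

Lemma quo_equiv_trans : transitive quo_equiv.
Proof.
move=> y x z /asboolP xy /asboolP yz; apply/asboolP.
by rewrite -[x](subrK y) -addrA; exact: JD.
Qed.

Canonical quo_equiv_equiv :=
  EquivRel quo_equiv quo_equiv_refl quo_equiv_sym quo_equiv_trans.

Definition quo := {eq_quot quo_equiv}.
HB.instance Definition _ : EqQuotient _ quo_equiv quo := EqQuotient.on quo.
HB.instance Definition _ := Choice.on quo.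

Definition cl x : quo := \pi_quo x.

Lemma cl_eq x y : cl x = cl y <-> J (x - y).
Proof.
split=> [/eqP|h]; first by rewrite /cl eqmodE => /asboolP.
by apply/eqP; rewrite /cl eqmodE; apply/asboolP.
Qed.

Lemma cl_repr (u : quo) : u = cl (repr u).
Proof. by rewrite /cl reprK. Qed.

Lemma cl_reprB x : J (repr (cl x) - x).
Proof. by apply/cl_eq; rewrite -cl_repr. Qed.

Lemma cl_ind (P : quo -> Prop) : (forall x, P (cl x)) -> forall u, P u.
Proof. by move=> h u; rewrite [u]cl_repr. Qed.

Definition quo_opp (u : quo) := cl (- repr u).
Definition quo_add (u v : quo) := cl (repr u + repr v).
Definition quo_mul (u v : quo) := cl (repr u * repr v).

Lemma quo_oppE x : quo_opp (cl x) = cl (- x).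
Proof. by apply/cl_eq; rewrite -opprD; apply/JN/cl_reprB. Qed.

Lemma quo_addE x y : quo_add (cl x) (cl y) = cl (x + y).
Proof. by apply/cl_eq; rewrite opprD addrACA; apply: JD; exact: cl_reprB. Qed.

Lemma quo_mulE x y : quo_mul (cl x) (cl y) = cl (x * y).
Proof.
apply/cl_eq; rewrite -(subrK (x * repr (cl y)) (_ * _)) -addrA.
rewrite -mulrBl -mulrBr; apply: JD.
  by apply: JMr; exact: cl_reprB.
by apply: ideal_left; exact: cl_reprB.
Qed.

Let quoE := (quo_oppE, quo_addE, quo_mulE).

Lemma quo_addA : associative quo_add.
Proof. by do 3 elim/cl_ind=> ?; rewrite !quoE addrA. Qed.
Lemma quo_addC : commutative quo_add.
Proof. by do 2 elim/cl_ind=> ?; rewrite !quoE addrC. Qed.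
Lemma quo_add0 : left_id (cl 0) quo_add.
Proof. by elim/cl_ind=> ?; rewrite !quoE add0r. Qed.
Lemma quo_addN : left_inverse (cl 0) quo_opp quo_add.
Proof. by elim/cl_ind=> ?; rewrite !quoE addNr. Qed.

HB.instance Definition _ := GRing.isZmodule.Build quo
  quo_addA quo_addC quo_add0 quo_addN.

Lemma quo_mulA : associative quo_mul.
Proof. by do 3 elim/cl_ind=> ?; rewrite !quoE mulrA. Qed.
Lemma quo_mul1 : left_id (cl 1) quo_mul.
Proof. by elim/cl_ind=> ?; rewrite !quoE mul1r. Qed.
Lemma quo_1mul : right_id (cl 1) quo_mul.
Proof. by elim/cl_ind=> ?; rewrite !quoE mulr1. Qed.
Lemma quo_mulDl : left_distributive quo_mul quo_add.
Proof. by do 3 elim/cl_ind=> ?; rewrite !quoE mulrDl. Qed.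
Lemma quo_mulDr : right_distributive quo_mul quo_add.
Proof. by do 3 elim/cl_ind=> ?; rewrite !quoE mulrDr. Qed.

HB.instance Definition _ := GRing.Zmodule_isPzRing.Build quo
  quo_mulA quo_mul1 quo_1mul quo_mulDl quo_mulDr.

Lemma clB x y : cl (x - y) = cl x - cl y.
Proof. by rewrite -quo_addE -quo_oppE. Qed.

Lemma cl_is_monoid_morphism : monoid_morphism cl.
Proof. by split=> // x y; rewrite -quo_mulE. Qed.

HB.instance Definition _ := GRing.isZmodMorphism.Build L quo cl clB.
HB.instance Definition _ := GRing.isMonoidMorphism.Build L quo cl
  cl_is_monoid_morphism.

Lemma cl_eq0 x : cl x = 0 <-> J x.
Proof. by rewrite -[0]/(cl 0) cl_eq subr0. Qed.

End QuotientRing.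

Section Semilocal.
Context (L : pzRingType) (P : two_sided_ideal L).
Implicit Types (x y z : L) (H m : set L).

Hypothesis chain_bound : exists n, forall U : nat -> set L,
  (forall i, right_ideal (U i) /\ (P : set L) `<=` U i) ->
  ~ forall i, (i < n)%N -> U i.+1 `<` U i.
(** This places [P] inside the Jacobson radical, since x y = 1 - z may be any element of 1 + P. *)
Hypothesis P_small : forall x y z, P z -> x * y + z = 1 -> exists y',
  x * y' = 1.

Definition over_ideal H := right_ideal H /\ (P : set L) `<=` H.

Definition max_over m := [/\ over_ideal m, ~ m 1 &
  forall H, right_ideal H -> m `<=` H -> ~ H 1 -> H `<=` m].

Lemma max_over_inv m t : max_over m -> ~ m t -> exists y, m (1 - t * y).
Proof.
move=> [[mid Pm] m1 mmax] mt; have [m0 mD mM] := mid.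
apply: contrapT => nex; apply: mt.
apply: (mmax [set x | exists y, m (x - t * y)]) => /=.
- split=> [|x y [a ma] [b mb]|x a [b mb]].
  + by exists 0; rewrite mulr0 subr0.
  + by exists (a + b); rewrite mulrDr opprD addrACA; exact: mD.
  + by exists (b * a); rewrite mulrA -mulrBl; exact: mM.
- by move=> x mx; exists 0; rewrite mulr0 subr0.
- exact: nex.
- by exists 1; rewrite mulr1 subrr.
Qed.

(** The bound on descending chains also bounds ascending ones: an endless ascending chain is read
    backwards through n - i. *)
Lemma max_over_exists H : over_ideal H -> ~ H 1 ->
  exists m, max_over m /\ H `<=` m.
Proof.
move=> [Hid PH] H1; apply: contrapT => nm.
pose good K := [/\ right_ideal K, H `<=` K & ~ K 1].
have step K : exists K', good K -> good K' /\ K `<` K'.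
  have [[Kid HK K1]|] := pselect (good K); last by exists K.
  apply: contrapT => nK; apply: nm; exists K; split=> //; split=> //.
    by split=> //; exact: subset_trans HK.
  move=> K' K'id KK' K'1; apply: contrapT => nK'; apply: nK; exists K' => _.
  by split; [split=> //; exact: subset_trans KK'|split].
have [F FP] := choice step.
have [n nP] := chain_bound.
have goodF k : good (iter k F H) by elim: k => [|k /FP[]]; first by split.
apply: (nP (fun i => iter (n - i) F H)) => [i|i lt_in] /=.
  by have [Kid HK _] := goodF (n - i)%N; split=> //; exact: subset_trans HK.
rewrite -(subnSK lt_in) /=; have [] // := FP (iter (n - i.+1) F H).
Qed.

Definition max_family r (M : 'I_r -> set L) :=
  (forall i, max_over (M i)) /\
  forall x, (forall i, M i x) -> forall m, max_over m -> m x.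

(** Otherwise finite intersections of maximal right ideals would form strictly descending chains of
    every length. *)
Lemma max_family_exists : exists r (M : 'I_r -> set L), max_family M.
Proof.
apply: contrapT => nM.
pose good K := exists r (M : 'I_r -> set L),
  (forall i, max_over (M i)) /\ K = [set x | forall i, M i x].
have goodT : good setT.
  exists 0, (fun=> setT); split; first by case.
  by apply/seteqP; split=> x // _ [].
have step K : exists K', good K -> good K' /\ K' `<` K.
  have [[r [M [Mmax KE]]]|] := pselect (good K); last by exists K.
  have [m [mmax [x [Kx mx]]]] : exists m, max_over m /\ exists x, K x /\ ~ m x.
    apply: contrapT => nm; apply: nM; exists r, M; split=> // x Mx m mmax.
    apply: contrapT => mx; apply: nm; exists m; split=> //; exists x.
    by rewrite KE.
  exists (K `&` m) => _; split; last by split=> [y []//|/(_ x Kx)[]].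
  exists r.+1, (fun i => if unlift ord0 i is Some j then M j else m); split.
    by move=> i; case: unliftP.
  apply/seteqP; split=> [y [+ my] i|y yM].
    by rewrite KE => My; case: unliftP => [j _|_] //; exact: My.
  split; last by have := yM ord0; rewrite unlift_none.
  by rewrite KE => j; have := yM (lift ord0 j); rewrite liftK.
have [F FP] := choice step; have [n nP] := chain_bound.
have goodF k : good (iter k F setT) by elim: k => [//|k /FP[]].
apply: (nP (fun i => iter i F setT)) => [i|i _]; last by case: (FP _ (goodF i)).
have [r [M [Mmax ->]]] := goodF i; split; last first.
  by move=> x Px j; have [[_ +] _ _] := Mmax j; apply.
split=> [j|x y Mx My j|x a Mx j]; have [[[M0 MD MM] _] _ _] := Mmax j => //.
  exact: MD.
exact: MM.
Qed.

(** A family of least cardinality will do. The separating elements become idempotents modulo the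
    radical. *)
Lemma max_family_irredundant : exists r (M : 'I_r -> set L), max_family M /\
  forall i, exists x, (forall j, j != i -> M j x) /\ ~ M i x.
Proof.
pose has_family r := `[< exists M : 'I_r -> set L, max_family M >].
have ex : exists r, has_family r.
  by have [r [M MP]] := max_family_exists; exists r; apply/asboolP; exists M.
case: (ex_minnP ex) => {ex} r /asboolP[M MP] rmin; have [Mmax Mcap] := MP.
exists r, M; split=> // i; apply: contrapT => nx.
case: r => [|r] in M MP rmin Mmax Mcap i nx *; first by case: i nx.
suff /rmin : has_family r by rewrite ltnn.
apply/asboolP; exists (M \o lift i); split=> [j|x Mx]; first exact: Mmax.
apply: Mcap => j; have Mj k : k != i -> M k x.
  by case: (unliftP i k) => [l ->|->]; [move=> _; exact: Mx|rewrite eqxx].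
have [->|] := eqVneq j i; last exact: Mj.
by apply: contrapT => Mi; apply: nx; exists x.
Qed.

(** [Q] is the quotient by the intersection [J] of the maximal right ideals above [P]. With t_i
    outside M_i but in the other members, and 1 - t_i g_i in M_i, the classes of the t_i g_i are
    orthogonal simple idempotents of sum 1. *)
Lemma semilocal_quotient : exists (Q : pzRingType) (pi : {rmorphism L -> Q}),
  [/\ forall u, exists x, pi x = u,
      forall x, pi x = 1 -> exists y, x * y = 1 &
      forall a : Q, exists u v, inverses u v /\ a * u * a = a].
Proof.
have [r [M [[Mmax Mcap] Mirr]]] := max_family_irredundant.
pose J := [set x : L | forall m, max_over m -> m x].
have Jr : right_ideal J.
  split=> [m|x y Jx Jy m mm|x a Jx m mm]; first by case=> [[[]]].
    by have [[[_ mD _] _] _ _] := mm; apply: mD; [exact: Jx|exact: Jy].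
  by have [[[_ _ mM] _] _ _] := mm; apply: mM; exact: Jx.
have Jl a x : J x -> J (a * x).
  move=> Jx m mm; have [[[m0 mD mM] Pm] m1 mmax] := mm.
  have [ma|ma] := pselect (m a); first exact: mM.
  (* For [a] outside [m], the preimage of [m] under left multiplication by [a] is again maximal;
     hence [J] is also a left ideal. *)
  suff : max_over [set y | m (a * y)] by exact: Jx.
  split=> /=; last 2 first.
  - by rewrite mulr1.
  - move=> H [H0 HD HM] sub H1 y Hy /=; apply: contrapT => may.
    have [z mz] := max_over_inv mm may; apply: H1.
    have <- : (1 - y * z * a) + y * (z * a) = 1 by rewrite mulrA subrK.
    apply: HD; last exact: HM.
    by apply: sub => /=; rewrite mulrBr mulr1 !mulrA -[X in X - _]mul1r
      -mulrBl; exact: mM.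
  split=> [|y Py /=]; last by apply: Pm; exact: ideal_left.
  split=> [|y z /= my mz|y b /= my]; first by rewrite /= mulr0.
    by rewrite mulrDr; exact: mD.
  by rewrite mulrA; exact: mM.
pose I := TwoSidedIdeal Jr Jl.
exists (quo I), (@cl L I : {rmorphism L -> quo I}); split.
- by elim/cl_ind=> x; exists x.
- move=> x /cl_eq Jx1.
  (* If x L + P were proper, it would lie in a maximal right ideal, which also contains 1 - x and
     hence 1. *)
  have [[y [z [Pz xyz]]]|nP] := pselect (exists y z, P z /\ x * y + z = 1).
    exact: P_small Pz xyz.
  have [P0 PD PM] := ideal_right P.
  have [] := @max_over_exists [set w | exists y z, P z /\ x * y + z = w].
  + split=> [|z Pz]; last by exists 0, z; rewrite mulr0 add0r.
    split=> [|_ _ [y [z [Pz <-]]] [y' [z' [Pz' <-]]]|_ a [y [z [Pz <-]]]].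
    * by exists 0, 0; rewrite mulr0 addr0.
    * by exists (y + y'), (z + z'); rewrite mulrDr addrACA; split=> //;
      exact: PD.
    * by exists (y * a), (z * a); rewrite mulrDl mulrA; split=> //; exact: PM.
  + exact: nP.
  move=> m [mm sub]; have [[mid _] m1 _] := mm; case: m1.
  have mx : m x by apply: sub; exists 1, 0; rewrite mulr1 addr0.
  by rewrite -[1](subKr x); apply: right_idealB => //; exact: Jx1.
have [t tP] := choice Mirr.
have inv i : exists g, M i (1 - t i * g).
  by have [_ ti] := tP i; exact: max_over_inv ti.
have [g gP] := choice inv.
pose e i := t i * g i.
have Mr i : right_ideal (M i) by case: (Mmax i) => [[]].
have MB i x z : M i x -> M i z -> M i (x - z) by exact: right_idealB.
have MM i x z : M i x -> M i (x * z) by case: (Mr i) => _ _; apply.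
have Te i j : j != i -> M j (e i) by move=> ji; apply: MM; case: (tP i) => + _;
  apply.
apply: (@unit_regular _ r (fun i => cl I (e i))) => [i|i j ij|].
- split.
    rewrite -rmorphM; apply/cl_eq; apply: Mcap => j.
    have [->|ji] := eqVneq j i; last by apply: MB; [apply: MM|]; exact: Te.
    have -> : e i * e i - e i = (1 - e i) * - e i by rewrite mulrN mulrBl mul1r
      opprB.
    by apply: MM; exact: gP.
  elim/cl_ind=> x; rewrite -rmorphM => ex0.
  have Mex : ~ M i (e i * x).
    move=> Mex; move/eqP: ex0; apply; apply/cl_eq0; apply: Mcap => j.
    by have [->//|ji] := eqVneq j i; apply: MM; exact: Te.
  have [z Mz] := max_over_inv (Mmax i) Mex.
  exists (cl I z); rewrite -rmorphM; apply/cl_eq; apply: Mcap => j.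
  have [->|ji] := eqVneq j i; last first.
    by apply: MB; [apply: (MM _ _ z); apply: (MM _ _ x)|]; exact: Te.
  have -> : e i * x * z - e i = (1 - e i) - (1 - e i * x * z).
    by rewrite opprB [RHS]addrC addrA subrK.
  by apply: MB => //; exact: gP.
- rewrite -rmorphM; apply/cl_eq0; apply: Mcap => k.
  have [->|ki] := eqVneq k i; last by apply: MM; exact: Te.
  have -> : e i * e j = e j - (1 - e i) * e j by rewrite mulrBl mul1r subKr.
  by apply: MB; [exact: Te|apply: MM; exact: gP].
- rewrite -rmorph_sum -(rmorph1 (@cl L I)); apply/cl_eq; apply: Mcap => k.
  rewrite (bigD1 k) //= addrC -addrA -[X in _ + X]opprB; apply: MB;
    last exact: gP.
  by apply: right_ideal_sum => // i ik; apply: Te; rewrite eq_sym.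
Qed.
End Semilocal.

(** * Localization of module-finite algebras *)

Section Primes.
Context (R : comPzRingType) (p : spec R).
Implicit Types a b d : R.

Lemma prime0 : prime_set p 0.
Proof. by case: (prime_setP p) => [[]]. Qed.

Lemma primeD a b : prime_set p a -> prime_set p b -> prime_set p (a + b).
Proof. by case: (prime_setP p) => [[_ + _] _ _]; apply. Qed.

Lemma primeMl a b : prime_set p b -> prime_set p (a * b).
Proof. by case: (prime_setP p) => [[_ _ +] _ _]; apply. Qed.

Lemma primeMr a b : prime_set p a -> prime_set p (a * b).
Proof. by rewrite mulrC; exact: primeMl. Qed.

Lemma primeN a : prime_set p a -> prime_set p (- a).
Proof. by rewrite -mulN1r; exact: primeMl. Qed.

Lemma prime_sum (I : Type) (s : seq I) (Q : pred I) (F : I -> R) :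
  (forall i, Q i -> prime_set p (F i)) -> prime_set p (\sum_(i <- s | Q i) F i).
Proof. by move=> QF; elim/big_ind: _ => //; [exact: prime0|exact: primeD]. Qed.

Lemma nprimeM a b : ~ prime_set p a -> ~ prime_set p b -> ~ prime_set p (a * b).
Proof. by move=> na nb; case: (prime_setP p) => _ _ pM /pM[]. Qed.

Lemma nprime1 : ~ prime_set p 1.
Proof. by case: (prime_setP p). Qed.

Lemma nprimeD a b : ~ prime_set p a -> prime_set p b -> ~ prime_set p (a + b).
Proof. by move=> na pb pab; apply: na; rewrite -[a](addrK b);
  apply/primeD/primeN. Qed.

Lemma nprime_prod (I : Type) (s : seq I) (F : I -> R) :
  (forall i, ~ prime_set p (F i)) -> ~ prime_set p (\prod_(i <- s) F i).
Proof. by move=> nF; elim/big_ind: _ => //; [exact: nprime1|exact: nprimeM].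
  Qed.

(** Modulo [p], only the identity permutation contributes to the determinant. *)
Lemma nprime_det n (D : 'M[R]_n) :
  (forall i j, i != j -> prime_set p (D i j)) ->
  (forall i, ~ prime_set p (D i i)) -> ~ prime_set p (\det D).
Proof.
move=> offdiag diag; rewrite /determinant (bigD1 (1%g : {perm _})) //=.
apply: nprimeD.
  rewrite odd_perm1 mul1r; apply: nprime_prod => i.
  by rewrite perm1.
apply: prime_sum => s s1; apply: primeMl.
have [i si] : exists i, s i != i.
  apply: contrapT => ns; move/eqP: s1; apply; apply/perm.permP => i.
  by rewrite perm1; apply/eqP; apply: contrapT => /negP si; apply: ns; exists i.
by rewrite (bigD1 i) //=; apply/primeMr/offdiag; rewrite eq_sym.
Qed.

(** Linear dependence over the residue field of [p], with denominators
    cleared. *)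
Lemma residue_dependence m (c : 'I_m.+1 -> 'I_m -> R) : exists l : 'I_m.+1 -> R,
  (exists i, ~ prime_set p (l i)) /\
  forall j, prime_set p (\sum_i l i * c i j).
Proof.
elim: m c => [|m IH] c.
  by exists (fun=> 1); split; [exists ord0; exact: nprime1|case].
have [[i0 ni0]|allp] := pselect (exists i, ~ prime_set p (c i ord0));
  last first.
  have [l [[i li] lP]] := IH (fun i j => c (lift ord0 i) (lift ord0 j)).
  exists (fun i => if unlift ord0 i is Some k then l k else 0); split.
    by exists (lift ord0 i); rewrite liftK.
  move=> j; rewrite (bigD1_ord ord0) //= unlift_none mul0r add0r.
  under eq_bigr do rewrite liftK.
  case: (unliftP ord0 j) => [k ->|->]; first exact: lP.
  apply: prime_sum => k _; apply: primeMl; apply: contrapT => ck.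
  by apply: allp; exists (lift ord0 k).
pose piv := c i0 ord0.
have [l [[i li] lP]] := IH (fun i j =>
  piv * c (lift i0 i) (lift ord0 j) - c (lift i0 i) ord0 * c i0 (lift ord0 j)).
pose l0 := - \sum_k l k * c (lift i0 k) ord0.
exists (fun i => if unlift i0 i is Some k then piv * l k else l0); split.
  by exists (lift i0 i); rewrite liftK; exact: nprimeM.
move=> j; rewrite (bigD1_ord i0) //= unlift_none.
under eq_bigr do rewrite liftK.
case: (unliftP ord0 j) => [k ->|->]; last first.
  rewrite /l0 mulNr mulr_suml -sumrN -big_split /=.
  apply: prime_sum => k _; rewrite (_ : _ + _ = 0); first exact: prime0.
  by rewrite /piv; ring.
have := lP k; congr prime_set.
rewrite /l0 mulNr mulr_suml -sumrN -big_split /=.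
by apply: eq_bigr => h _; rewrite /piv; ring.
Qed.

End Primes.

Section LocalRing.
Context (R : comPzRingType) (E : algebra R) (p : spec R).
Local Notation iota := (alg_map E).

Definition loc_in (x : E) : loc_alg E p := alg_frac x (denom1 p).

Lemma alg_frac_eqP (x y : E) (s t : denom p) : alg_frac x s = alg_frac y t <->
  exists u : denom p, iota (dval u * dval t) * x = iota (dval u * dval s) * y.
Proof.
rewrite /alg_frac frac_eq; split=> -[u e]; exists u.
  by rewrite !rmorphM -!mulrA; exact: e.
by move: e; rewrite !rmorphM -!mulrA.
Qed.

Lemma loc_inB : {morph loc_in : x y / x - y}.
Proof.
move=> x y; have := @fracDr R p (algmod E) x (- (y : algmod E)) (denom1 p).
move=> e; apply: (etrans (esym e)); congr (_ + _); exact/esym/loc_oppE.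
Qed.

Lemma loc_in_monoid : monoid_morphism loc_in.
Proof.
by split=> // x y; rewrite /loc_in alg_fracM; apply: alg_frac_eq;
  rewrite //= mulr1.
Qed.

HB.instance Definition _ := GRing.isZmodMorphism.Build E (loc_alg E p) loc_in
  loc_inB.
HB.instance Definition _ :=
  GRing.isMonoidMorphism.Build E (loc_alg E p) loc_in loc_in_monoid.

Definition loc_mor : {rmorphism E -> loc_alg E p} := loc_in.

End LocalRing.

Section ModuleFinite.
Context (R : comPzRingType) (E : algebra R) (p : spec R).
Hypothesis E_fin : fin_gen (algmod E).
Local Notation iota := (alg_map E).
Local Notation out d := (~ prime_set p d).

Lemma module_finite_generators : exists n (e : 'I_n -> E),
  forall v, exists c : 'I_n -> R, v = \sum_i iota (c i) * e i.
Proof. by have [n [e eP]] := E_fin; exists n, e. Qed.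

(** The extended ideal p E. *)
Definition prime_extension : set E := [set x | exists n (c : 'I_n -> R) (y :
  'I_n -> E),
  (forall i, prime_set p (c i)) /\ x = \sum_i iota (c i) * y i].

Lemma prime_extension1 r x : prime_set p r -> prime_extension (iota r * x).
Proof. by move=> pr; exists 1, (fun=> r), (fun=> x); rewrite big_ord1. Qed.

Lemma prime_extensionP n (e : 'I_n -> E) x :
  (forall v, exists c : 'I_n -> R, v = \sum_i iota (c i) * e i) ->
  prime_extension x ->
  exists c : 'I_n -> R, (forall i, prime_set p (c i)) /\ x =
    \sum_i iota (c i) * e i.
Proof.
move=> eP [m [c [y [pc ->]]]]; have [b bP] := choice (fun i => eP (y i)).
exists (fun k => \sum_i c i * b i k); split.
  by move=> k; apply: prime_sum => i _; apply: primeMr.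
under [RHS]eq_bigr do rewrite rmorph_sum mulr_suml.
rewrite exchange_big; apply: eq_bigr => i _; rewrite {1}bP mulr_sumr.
by apply: eq_bigr => k _; rewrite rmorphM mulrA.
Qed.

Lemma prime_extension_right : right_ideal prime_extension.
Proof.
split.
- by exists 0, (fun=> 0), (fun=> 0); split; [case|rewrite big_ord0].
- have [k [e eP]] := module_finite_generators.
  move=> x y /(prime_extensionP eP)[c [pc ->]] /(prime_extensionP eP)[d [pd
    ->]].
  exists k, (fun i => c i + d i), e; split=> [i|]; first exact: primeD.
  by rewrite -big_split; apply: eq_bigr => i _; rewrite rmorphD mulrDl.
- move=> _ a [n [c [y [pc ->]]]]; exists n, c, (fun i => y i * a); split=> //.
  by rewrite mulr_suml; apply: eq_bigr => i _; rewrite mulrA.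
Qed.

Lemma prime_extension_left a x : prime_extension x -> prime_extension (a * x).
Proof.
move=> [n [c [y [pc ->]]]]; exists n, c, (fun i => a * y i); split=> //.
by rewrite mulr_sumr; apply: eq_bigr => i _; rewrite mulrA -alg_mapC mulrA.
Qed.

(** If the generators of [E] are multiplied by [d + x] through the matrix [D],
    then the adjugate of [D] yields a right inverse of [d + x] up to
    [\det D]. *)
Lemma prime_extension_inv d x : out d -> prime_extension x ->
  exists v d', out d' /\ (iota d + x) * v = iota d'.
Proof.
move=> pd px; have [n [e eP]] := module_finite_generators.
have [_ _ PM] := prime_extension_right.
have [c cP] := choice (fun i => prime_extensionP eP (PM _ (e i) px)).
pose D := \matrix_(i, k) (d *+ (i == k) + c i k).
have DP i : (iota d + x) * e i = \sum_k iota (D i k) * e k.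
  rewrite mulrDl (cP i).2 (bigD1 i) //= [RHS](bigD1 i) //= !mxE eqxx rmorphD.
  rewrite mulrDl addrA; congr (_ + _); apply: eq_bigr => k ki.
  by rewrite mxE eq_sym (negPf ki) add0r.
have detP l : (iota d + x) * (\sum_i iota (\adj D l i) * e i) =
  iota (\det D) * e l.
  rewrite mulr_sumr; under eq_bigr do rewrite mulrA -alg_mapC -mulrA DP
    mulr_sumr.
  rewrite exchange_big /= (bigD1 l) //= [X in _ + X]big1 => [|k kl].
    under eq_bigr do rewrite mulrA -rmorphM.
    rewrite -mulr_suml -rmorph_sum addr0; congr (iota _ * _).
    by have := congr1 (fun A : 'M_n => A l l) (mul_adj_mx D); rewrite !mxE eqxx.
  under eq_bigr do rewrite mulrA -rmorphM.
  rewrite -mulr_suml -rmorph_sum.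
  have := congr1 (fun A : 'M_n => A l k) (mul_adj_mx D).
  by rewrite !mxE eq_sym (negPf kl) => ->; rewrite rmorph0 mul0r.
have [u uP] := eP 1.
exists (\sum_l iota (u l) * (\sum_i iota (\adj D l i) * e i)), (\det D); split.
  apply: nprime_det => [i j ij|i]; rewrite mxE.
    by rewrite (negPf ij) add0r; case: (cP i).
  by rewrite eqxx; apply: nprimeD => //; case: (cP i).
rewrite mulr_sumr; under eq_bigr do rewrite mulrA -alg_mapC -mulrA detP.
rewrite -[RHS]mulr1 [in RHS]uP mulr_sumr; apply: eq_bigr => l _.
by rewrite !mulrA -!rmorphM mulrC.
Qed.

Local Notation L := (loc_alg E p).
Local Notation j := (@loc_mor R E p).

Lemma loc_inP z : exists x d, out d /\ z * j (iota d) = j x.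
Proof.
elim/alg_frac_ind: z => x s; exists x, (dval s); split; first exact: denomP.
rewrite /= /loc_in alg_fracM; apply/alg_frac_eqP; exists (denom1 p).
by rewrite /= !mul1r !mulr1 rmorph1 mul1r alg_mapC.
Qed.

Lemma loc_in_inj x y : j x = j y -> exists u, out u /\ iota u * x = iota u * y.
Proof.
move=> /alg_frac_eqP[u]; rewrite /= mulr1 => e.
by exists (dval u); split=> //; exact: denomP.
Qed.

Lemma loc_in_central d z : j (iota d) * z = z * j (iota d).
Proof.
elim/alg_frac_ind: z => x s; rewrite /= /loc_in !alg_fracM; apply: alg_frac_eq.
  exact: alg_mapC.
by rewrite /= mulrC.
Qed.

Lemma loc_in_unit d : out d -> exists m, j (iota d) * m = 1.
Proof.
move=> pd; exists (alg_frac 1 (Denom pd)); rewrite /= /loc_in alg_fracM mulr1.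
by apply/alg_frac_eqP; exists (denom1 p); rewrite /= !mul1r rmorph1 mul1r mulr1.
Qed.

(** Modulo [P] the localization is a vector space over the residue field of [p], spanned by the [m]
    generators. Given m + 1 elements x_i in [U i] but not in [U i.+1], take a dependence relation
    modulo [p]: the least [i0] whose coefficient is outside [p] would put x_i0 in [U i0.+1]. *)
Lemma loc_chain_bound (P : two_sided_ideal L) :
  (forall x, prime_extension x -> P (j x)) ->
  exists n, forall U : nat -> set L,
    (forall i, right_ideal (U i) /\ (P : set L) `<=` U i) ->
    ~ forall i, (i < n)%N -> U i.+1 `<` U i.
Proof.
move=> PP; have [m [e eP]] := module_finite_generators.
exists m.+1 => U UP Udec.
have ex (i : 'I_m.+1) : exists x : E, U i (j x) /\ ~ U i.+1 (j x).
  have [_ /existsNP[z /not_implyP[Uz nUz]]] := Udec i (ltn_ord i).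
  have [x [d [pd zx]]] := loc_inP z; exists x; rewrite -zx; split.
    by have [[_ _ UM] _] := UP i; exact: UM.
  have [k dk] := loc_in_unit pd; move=> Uzd; apply: nUz.
  have -> : z = z * j (iota d) * k by rewrite -mulrA dk mulr1.
  by have [[_ _ UM] _] := UP i.+1; exact: UM.
have [x xP] := choice ex.
have [c cP] := choice (fun i => eP (x i)).
have [l [[i1 li1] lP]] := residue_dependence p c.
pose bad i := `[< out (l i) >].
have bad1 : bad i1 by apply/asboolP.
case: (arg_minnP (fun i : 'I_m.+1 => i : nat) bad1) => i0 /asboolP bad0 i0min.
have mono (i k : nat) : (i <= k)%N -> (k <= m.+1)%N -> U k `<=` U i.
  elim: k => [|k IH]; first by rewrite leqn0 => /eqP-> _ x0.
  move=> + km; rewrite leq_eqVlt => /predU1P[->|ik]; first exact: subset_refl.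
  apply: subset_trans (IH ik (ltnW km)).
  by have [] := Udec k km.
have [Ur UPs] := UP i0.+1; have [U0 UD UM] := Ur.
have [_ nx0] := xP i0; apply: nx0.
have Ul i : i != i0 -> U i0.+1 (j (iota (l i) * x i)).
  move=> ii0; have [pl|pl] := pselect (prime_set p (l i)).
    exact/UPs/PP/prime_extension1.
  rewrite rmorphM loc_in_central; apply: UM.
  have lt_i : (i0 < i)%N.
    rewrite ltn_neqAle; apply/andP; split; first by rewrite val_eqE eq_sym.
    exact/i0min/asboolP.
  by apply: (mono i0.+1 i lt_i); [exact: ltnW|case: (xP i)].
have Usum : U i0.+1 (j (\sum_i iota (l i) * x i)).
  apply/UPs/PP.
  exists m, (fun k => \sum_i l i * c i k), e; split=> //.
  under eq_bigr do rewrite {1}cP mulr_sumr.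
  rewrite exchange_big; apply: eq_bigr => k _; rewrite rmorph_sum mulr_suml.
  by apply: eq_bigr => i _; rewrite rmorphM mulrA.
have [k lk] := loc_in_unit bad0.
have -> : j (x i0) = j (iota (l i0) * x i0) * k.
  by rewrite rmorphM loc_in_central -mulrA lk mulr1.
apply: UM; move: Usum; rewrite (bigD1 i0) //= => Usum.
rewrite -[iota _ * _](addrK (\sum_(i | i != i0) iota (l i) * x i)) rmorphB.
apply: right_idealB => //; rewrite rmorph_sum.
by apply: right_ideal_sum.
Qed.

(** [Q] is the localization at [p] modulo its radical, seen from [E]. Denominators are cleared so
    that later arguments stay inside [E]; the fourth clause is the lifting of right invertibility
    along [rho]. *)
Lemma residue_quotient : exists (Q : pzRingType) (rho : {rmorphism E -> Q}),
  [/\ forall q, exists x d, out d /\ q * rho (iota d) = rho x,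
      forall d, out d -> exists m, rho (iota d) * m = 1,
      forall d q, rho (iota d) * q = q * rho (iota d),
      forall x d, out d -> rho x = rho (iota d) ->
        exists v d', out d' /\ x * v = iota d' &
      forall a : Q, exists u v, inverses u v /\ a * u * a = a].
Proof.
(* The ideal generated by [p] in the localization. *)
pose PL := [set z | exists x d, [/\ prime_extension x,
  out d & z * j (iota d) = j x]].
have [P0 PD PM] := prime_extension_right.
have PLr : right_ideal PL.
  split.
  - by exists 0, 1; split=> //; [exact: nprime1|rewrite mul0r rmorph0].
  - move=> z z' [x [d [px pd zx]]] [x' [d' [px' pd' zx']]].
    exists (x * iota d' + x' * iota d), (d * d'); split.
    + by apply: PD; apply: PM.
    + exact: nprimeM.
    + rewrite !rmorphM rmorphD !rmorphM -zx -zx' mulrDl -!mulrA;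
      congr (_ + z' * _).
      exact: loc_in_central.
  - move=> z a [x [d [px pd zx]]]; have [y [d' [pd' ay]]] := loc_inP a.
    exists (x * y), (d * d'); split; [exact: PM|exact: nprimeM|].
    by rewrite !rmorphM -zx -ay !mulrA -(mulrA z a) -(loc_in_central d a) mulrA.
have PLl a z : PL z -> PL (a * z).
  move=> [x [d [px pd zx]]]; have [y [d' [pd' ay]]] := loc_inP a.
  exists (y * x), (d * d'); split; [exact: prime_extension_left|exact:
    nprimeM|].
  rewrite !rmorphM -zx -ay !mulrA -(mulrA a (j (iota d')) z) (loc_in_central d'
    z).
  by rewrite !mulrA -(mulrA (a * z)) (loc_in_central d) mulrA.
pose P := TwoSidedIdeal PLr PLl.
have PP x : prime_extension x -> P (j x).
  by move=> px; exists x, 1; split=> //; [exact: nprime1|rewrite !rmorph1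
    mulr1].
have [|Q [pi [pi_surj pi1 ureg]]] := semilocal_quotient (loc_chain_bound PP).
  move=> x y z [w [d [pw pd zw]]] xyz.
  have [v [d' [pd' wv]]] := prime_extension_inv pd (PM _ (-1) pw).
  have [k dk] := loc_in_unit pd'.
  exists (y * (j (iota d * v) * k)).
  have xy : x * y = 1 - z by rewrite -xyz addrK.
  rewrite mulrA xy -[RHS]dk mulrA; congr (_ * _).
  by rewrite -wv mulrN1 !rmorphM rmorphB -zw mulrA mulrBl mul1r.
exists Q, (pi \o j : {rmorphism E -> Q}); split=> //=.
- move=> q; have [z <-] := pi_surj q; have [x [d [pd zx]]] := loc_inP z.
  by exists x, d; split=> //; rewrite -rmorphM zx.
- move=> d /loc_in_unit[m dm]; exists (pi m).
  by rewrite -rmorphM dm rmorph1.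
- by move=> d q; have [z <-] := pi_surj q; rewrite -!rmorphM loc_in_central.
- move=> x d pd /= xd; have [m dm] := loc_in_unit pd.
  have [|y xy] := pi1 (j x * m); first by rewrite rmorphM xd -rmorphM dm
    rmorph1.
  have [w [d1 [pd1 yw]]] := loc_inP (m * y).
  have [|u [pu uxw]] := @loc_in_inj (x * w) (iota d1).
    by rewrite rmorphM -yw !mulrA xy mul1r.
  exists (iota u * w), (u * d1); split; first exact: nprimeM.
  by rewrite mulrA -alg_mapC -mulrA uxw rmorphM.
Qed.

End ModuleFinite.

(** * Unit-regularity transferred to the algebra, up to denominators *)

Section ClearDenominators.
Context (R : comPzRingType) (E : algebra R) (p : spec R).
Hypothesis E_fin : fin_gen (algmod E).
Local Notation iota := (alg_map E).
Local Notation out d := (~ prime_set p d).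
Implicit Types (b c e x y : E) (d : R).

Lemma residue_quotient_unit : exists (Q : pzRingType) (rho :
  {rmorphism E -> Q}),
  [/\ forall q, exists x d, out d /\ q * rho (iota d) = rho x,
      forall d, out d -> exists m, [/\ rho (iota d) * m = 1,
        m * rho (iota d) = 1 &
        forall q, m * q = q * m],
      forall d q, rho (iota d) * q = q * rho (iota d),
      forall x d, out d -> rho x = rho (iota d) ->
        exists v d', out d' /\ x * v = iota d' &
      forall a : Q, exists u v, inverses u v /\ a * u * a = a].
Proof.
have [Q [rho [rho_frac rho_unit rhoC rho_lift ureg]]] :=
  residue_quotient p E_fin.
exists Q, rho; split=> // d /rho_unit[m dm];
  have md : m * rho (iota d) = 1 by rewrite -rhoC.
exists m; split=> // q.
transitivity (m * (q * rho (iota d)) * m); first by rewrite -!mulrA dm mulr1.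
by rewrite -rhoC mulrA md mul1r.
Qed.

Lemma finite_dedekind x y d : out d -> x * y = iota d ->
  exists v d', out d' /\ y * v = iota d'.
Proof.
move=> pd xy.
have [Q [rho [rho_frac rho_unit rhoC rho_lift ureg]]] := residue_quotient_unit.
have [m [dm md mC]] := rho_unit d pd.
have yx : rho y * (m * rho x) = 1.
  by apply: unit_regular_dedekind => //; rewrite -mulrA -rmorphM xy.
have [w [d1 [pd1 xw]]] := rho_frac (m * rho x).
have [|v [d2 [pd2 wv]]] := rho_lift (y * w) d1 pd1.
  by rewrite rmorphM -xw mulrA yx mul1r.
by exists (w * v), d2; rewrite mulrA.
Qed.

Lemma finite_left_inverse x y d : out d -> x * y = iota d ->
  exists v d', out d' /\ v * x = iota d'.
Proof.
move=> pd xy; have [w [d' [pd' yw]]] := finite_dedekind pd xy.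
exists (y * iota d'), (d * d'); split; first exact: nprimeM.
have xd : x * iota d' = iota d * w by rewrite -yw mulrA xy.
by rewrite -mulrA alg_mapC xd mulrA -alg_mapC -mulrA yw rmorphM.
Qed.

Lemma finite_stable_range a b x y d : out d -> x * a + y * b = iota d ->
  exists z, forall l, out l ->
    exists v d', out d' /\ v * (a + iota l * z * b) = iota d'.
Proof.
move=> pd xayb.
have [Q [rho [rho_frac rho_unit rhoC rho_lift ureg]]] := residue_quotient_unit.
have [m [dm md mC]] := rho_unit d pd.
have := @unit_regular_stable_range _ ureg (rho a) (rho b) (m * rho x) (m * rho
  y).
rewrite -!mulrA -mulrDr -!rmorphM -rmorphD xayb md => /(_ erefl)[z zP].
(* [c] is a denominator of [z]. Using l c as multiplier in the quotient lets the same [z0] serve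
   every [l]. *)
have [z0 [c [pc zc]]] := rho_frac z; exists z0 => l pl.
have [k [lk kl kC]] := rho_unit (l * c) (nprimeM pl pc).
have [v] := zP (rho (iota (l * c))) k (rhoC _) kC lk.
have -> : rho a + rho (iota (l * c)) * z * rho b = rho (a + iota l * z0 * b).
  rewrite rmorphD !rmorphM -zc; congr (_ + _ * _).
  by rewrite -!mulrA (rhoC c).
move=> vab; have [v0 [d1 [pd1 vv]]] := rho_frac v.
have [|w [d2 [pd2 vw]]] := rho_lift (v0 * (a + iota l * z0 * b)) d1 pd1.
  by rewrite rmorphM -vv -mulrA rhoC mulrA vab mul1r.
have [u [d3 [pd3 uv]]] := finite_left_inverse pd2 vw.
by exists (u * v0), d3; rewrite -mulrA.
Qed.

Lemma finite_drop e c x y d : out d -> e * e = e -> e * y = y -> x + c * y =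
  iota d ->
  exists u v d', out d' /\ (1 - e) * u * x * v = iota d' * (1 - e).
Proof.
move=> pd ee ey xcy.
have [Q [rho [rho_frac rho_unit rhoC rho_lift ureg]]] := residue_quotient_unit.
have [m [dm md mC]] := rho_unit d pd.
have [|||u [z]] := @unit_regular_drop _ ureg (rho e) (m * rho c) (rho y) (m *
  rho x).
- by rewrite -rmorphM ee.
- by rewrite -rmorphM ey.
- by rewrite -mulrA -mulrDr -rmorphM -rmorphD xcy.
have [u0 [a [pa ua]]] := rho_frac u; have [z0 [b [pb zb]]] :=
  rho_frac (m * z) => uz.
(* The summand in [e] completes the other one to an element whose image is the scalar a b;
   multiplying by 1 - e at the end removes it again. *)
have [|v [d' [pd' vP]]] := rho_lift (e * iota (a * b) + (1 - e) * u0 * x * z0)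
  _ (nprimeM pa pb).
  rewrite rmorphD !rmorphM rmorphB rmorph1 -ua -zb.
  have -> : (1 - rho e) * (u * rho (iota a)) * rho x * (m * z * rho (iota b)) =
      (1 - rho e) * (rho (iota a) * rho (iota b)).
    transitivity ((1 - rho e) * u * (rho (iota a) * (rho x * m * z)) * rho
      (iota b)).
      by rewrite !mulrA.
    by rewrite rhoC -mC -[in RHS]uz !mulrA.
  by rewrite -mulrDl addrC subrK mul1r.
exists u0, (z0 * v), d'; split=> //.
have e0 : (1 - e) * e = 0 by rewrite mulrBl mul1r ee subrr.
have e1 : (1 - e) * (1 - e) = 1 - e by rewrite mulrBr mulr1 e0 subr0.
by rewrite alg_mapC -vP mulrA mulrDr !mulrA e0 !mul0r add0r e1.
Qed.
End ClearDenominators.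

(** * Local rank of matrices over a module-finite algebra *)

Lemma fin_gen_finite (A : pzRingType) (V : lmodType A) (T : finType) (g :
  T -> V) :
  (forall v, exists c : T -> A, v = \sum_i c i *: g i) -> fin_gen V.
Proof.
move=> gP; exists #|T|, (fun i => g (enum_val i)) => v.
have [c ->] := gP v; exists (fun i => c (enum_val i)).
by rewrite (reindex (@enum_val T T)) //; apply: onW_bij; exact: enum_val_bij.
Qed.

Section MatrixAlgebra.
Context (R : comPzRingType) (A : algebra R).
Local Notation iota := (alg_map A).

Definition mx_scalar s : {rmorphism R -> 'M[A]_s} := @scalar_mx A s \o iota.

Lemma scalar_mx_central m n r (X : 'M[A]_(m, n)) :
  (iota r)%:M *m X = X *m (iota r)%:M.
Proof.
apply/matrixP => i j; rewrite !mxE (bigD1 i) //= [RHS](bigD1 j) //= !mxE !eqxx.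
rewrite [X in _ + X]big1 ?[X in _ = _ + X]big1 ?alg_mapC // => k kj.
  by rewrite !mxE (negPf kj) mulr0.
by rewrite !mxE eq_sym (negPf kj) mul0r.
Qed.

Lemma mx_scalarC s r (X : 'M[A]_s) : mx_scalar s r * X = X * mx_scalar s r.
Proof. exact: scalar_mx_central. Qed.

Definition mx_alg s : algebra R := Algebra (@mx_scalarC s).

Lemma mx_alg_fin s : fin_gen (algmod A) -> fin_gen (algmod (mx_alg s)).
Proof.
move=> [n [g gP]].
pose E (x : 'I_n * 'I_s * 'I_s) : 'M[A]_s :=
  \matrix_(i, j) if (i == x.1.2) && (j == x.2) then (g x.1.1 : A) else 0.
apply: (@fin_gen_finite _ (algmod (mx_alg s)) _ (E :
  _ -> algmod (mx_alg s))) => X.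
have [c cP] := choice (fun ij : 'I_s * 'I_s => gP ((X : 'M[A]_s) ij.1 ij.2)).
exists (fun x => c (x.1.2, x.2) x.1.1).
have -> : \sum_i c (i.1.2, i.2) i.1.1 *: (E i : algmod (mx_alg s)) =
   \sum_i (iota (c (i.1.2, i.2) i.1.1))%:M *m E i :> 'M[A]_s by [].
apply/matrixP => k l; rewrite (cP (k, l)) summxE.
rewrite -(pair_bigA _ (fun x y => ((iota (c (x.2, y) x.1))%:M *m E (x,
  y)) k l)) /=.
rewrite -(pair_bigA _ (fun i x => \sum_y ((iota (c (x, y) i))%:M *m E (i, x,
  y)) k l)) /=.
apply: eq_bigr => i _; rewrite (bigD1 k) //= (bigD1 l) //= [X in _ + X + _]big1
  ?addr0 => [|j jl].
  rewrite [X in _ + X]big1 ?addr0 => [|j jk].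
    by rewrite mul_scalar_mx !mxE !eqxx.
  by rewrite big1 // => h _; rewrite mul_scalar_mx !mxE /= eq_sym (negPf jk)
    mulr0.
by rewrite mul_scalar_mx !mxE /= eqxx eq_sym (negPf jl) mulr0.
Qed.

End MatrixAlgebra.

Section LocalRank.
Context (R : comPzRingType) (A : algebra R).
Hypothesis A_fin : fin_gen (algmod A).
Local Notation iota := (alg_map A).
Local Notation out p d := (~ prime_set p d).

Definition rank_at (p : spec R) u v (phi : 'M[A]_(u, v)) (s : nat) :=
  exists (C : 'M[A]_(s, u)) (G : 'M[A]_(v, s)) (d : R),
    out p d /\ C *m phi *m G = (iota d)%:M.

Lemma rank_at_le p u v (phi : 'M[A]_(u, v)) s t :
  (t <= s)%N -> rank_at p phi s -> rank_at p phi t.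
Proof.
move=> ts [C [G [d [pd CG]]]].
exists (pid_mx t *m C), (G *m pid_mx t), d; split=> //.
rewrite -!mulmxA (mulmxA phi) (mulmxA C) (mulmxA C) CG.
by rewrite scalar_mx_central mulmxA pid_mx_id // pid_mx_1 mul1mx.
Qed.

Lemma rank_atMl p u u' v (T : 'M[A]_(u', u)) (phi : 'M[A]_(u, v)) s :
  rank_at p (T *m phi) s -> rank_at p phi s.
Proof. by move=> [C [G [d [pd CG]]]]; exists (C *m T), G, d;
  rewrite -(mulmxA C). Qed.

Lemma rank_at_open p u v (phi : 'M[A]_(u, v)) s : rank_at p phi s ->
  exists d, out p d /\ forall q, out q d -> rank_at q phi s.
Proof.
by move=> [C [G [d [pd CG]]]]; exists d; split=> // q qd; exists C, G, d.
Qed.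

(** C phi G = d changes by an element of the extension of [p] to the matrix algebra, and
    [prime_extension_inv] still inverts the sum up to a scalar outside [p]. *)
Lemma rank_at_congr p u v (phi psi : 'M[A]_(u, v)) r s : prime_set p r ->
  rank_at p phi s -> rank_at p (phi + (iota r)%:M *m psi) s.
Proof.
move=> pr [C [G [d [pd CG]]]].
have px := @prime_extension1 R (mx_alg A s) p r (C *m psi *m G) pr.
have [V [d' [pd' dV]]] := prime_extension_inv (mx_alg_fin s A_fin) pd px.
exists C, (G *m V), d'; split=> //; rewrite -[RHS]dV [RHS]/(_ *m _).
rewrite mulmxA mulmxDr mulmxDl CG; congr ((_ + _) *m _).
transitivity ((iota r)%:M *m (C *m psi *m G)); last by [].
by rewrite mulmxA -(scalar_mx_central _ C) -!mulmxA.
Qed.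

(** Here [C] and phi G are square, so Dedekind finiteness turns a left inverse of phi G into a right
    one. *)
Lemma rank_at_full p t v (phi : 'M[A]_(t, v)) : rank_at p phi t ->
  exists (G : 'M[A]_(v, t)) d, out p d /\ phi *m G = (iota d)%:M.
Proof.
move=> [C [G [d [pd CG]]]].
have xy : (C : mx_alg A t) * (phi *m G : mx_alg A t) = alg_map (mx_alg A t) d.
  by rewrite [LHS]mulmxA.
have [V [d' [pd' GV]]] := finite_dedekind (mx_alg_fin t A_fin) pd xy.
by exists (G *m V), d'; rewrite mulmxA.
Qed.

(** In square matrices of size 1 + s, d = C' phi G + c (y G). Padded by zeros, y G is fixed by the
    matrix unit [e] on the left, so [finite_drop] leaves rank [s] to [phi] on the block 1 - e. *)
Lemma rank_at_drop p u v (y : 'M[A]_(1, v)) (phi : 'M[A]_(u, v)) s :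
  rank_at p (col_mx y phi) s.+1 -> rank_at p phi s.
Proof.
move=> [C [G [d [pd]]]]; rewrite -[C](@hsubmxK _ s.+1 1 u) mul_row_col => CG.
set c := lsubmx _ in CG; set C' := rsubmx _ in CG.
pose e : mx_alg A (1 + s) := block_mx 1%:M 0 0 0 : 'M[A]_(1 + s).
pose cc : mx_alg A (1 + s) := row_mx c 0 : 'M[A]_(1 + s, 1 + s).
pose yy : mx_alg A (1 + s) := col_mx (y *m G) 0 : 'M[A]_(1 + s, 1 + s).
pose xx : mx_alg A (1 + s) := C' *m phi *m G.
have ee : e * e = e.
  by rewrite [LHS]mulmx_block !mulmx0 !mul0mx mulmx1 !addr0.
have ey : e * yy = yy.
  by rewrite [LHS]mul_block_col !mulmx0 !mul0mx mul1mx !addr0.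
have xcy : xx + cc * yy = alg_map (mx_alg A (1 + s)) d.
  by rewrite [cc * yy]mul_row_col mulmx0 addr0 mulmxA addrC -mulmxDl.
have [U [V [d' [pd' UV]]]] := finite_drop (mx_alg_fin (1 + s) A_fin) pd ee ey
  xcy.
have e1 : 1 - e = block_mx 0 0 0 1%:M :> 'M[A]_(1 + s).
  rewrite -[1]/(1%:M : 'M[A]_(1 + s)) scalar_mx_block /e.
  by rewrite opp_block_mx add_block_mx subrr !subr0.
pose UU : 'M[A]_(1 + s) := (1 - e) * U.
exists (dsubmx UU *m C'), (G *m rsubmx (V : 'M[A]_(1 + s))), d'; split=> //.
have : UU *m (C' *m phi *m G) *m V = (iota d')%:M *m block_mx 0 0 0 1%:M.
  by rewrite -e1; exact: UV.
rewrite [in X in _ = X](@scalar_mx_block _ 1 s) mulmx_block !mulmx0 !mul0mx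
  !addr0 mulmx1 add0r.
move=> /(congr1 (fun X : 'M[A]_(1 + s) => drsubmx X)).
rewrite block_mxKdr => <-.
by rewrite /drsubmx -!mul_dsub_mx -mulmx_rsub !mulmxA.
Qed.

(** Splitting [C] into (c, C1, C2) and [phi] into (phi1, phi2), one has C1 phi1 G + (C2 phi2 + c y)
    G = d. Stable range for square matrices of size [s] makes phi1 G + l z (C2 phi2 + c y) G left
    invertible up to a scalar outside [p]: the part in c y is the modification of [phi] by a = (z c,
    0), and the part in C2 phi2 is absorbed into the new left factor. *)
Lemma rank_at_reduce p u v (y : 'M[A]_(1, v)) (phi : 'M[A]_(u, v)) s :
  (s <= u)%N -> rank_at p (col_mx y phi) s ->
  exists a : 'M[A]_(u, 1), forall l, out p l ->
    rank_at p (phi + (iota l)%:M *m a *m y) s.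
Proof.
move=> /subnKC su; move: (u - s)%N su => w su; case: u / su in phi *.
move=> [C [G [d [pd]]]]; rewrite -[C](@hsubmxK _ s 1 (s + w)) mul_row_col.
set c := lsubmx _; set C' := rsubmx _.
rewrite -[C']hsubmxK -[phi]vsubmxK mul_row_col.
set C1 := lsubmx C'; set C2 := rsubmx C'.
set phi1 := usubmx phi; set phi2 := dsubmx phi => CG.
pose a1 : mx_alg A s := phi1 *m G.
pose b1 : mx_alg A s := (C2 *m phi2 + c *m y) *m G.
have xayb : (C1 : mx_alg A s) * a1 + 1 * b1 = alg_map (mx_alg A s) d.
  transitivity ((C1 *m phi1 + (C2 *m phi2 + c *m y)) *m G); last first.
    by rewrite addrA [_ + c *m y]addrC.
  by rewrite mul1r [RHS]mulmxDl -mulmxA.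
have [z zP] := finite_stable_range (mx_alg_fin s A_fin) pd xayb.
exists (col_mx ((z : 'M[A]_s) *m c) 0) => l pl;
  have [V [d' [pd' Vd]]] := zP l pl.
exists (row_mx V ((V : 'M[A]_s) *m (iota l)%:M *m (z : 'M[A]_s) *m C2)), G, d';
  split=> //.
pose T : 'M[A]_s := (iota l)%:M *m z; pose V' : 'M[A]_s := V.
transitivity (V' *m (phi1 *m G + T *m ((C2 *m phi2 + c *m y) *m G)));
  last exact: Vd.
have -> : (iota l)%:M *m col_mx ((z : 'M[A]_s) *m c) 0 =
  col_mx (T *m c) 0 :> 'M[A]_(s + w, 1).
  by rewrite (@scalar_mx_block _ s w) mul_block_col !mulmx0 !mul0mx !addr0
    mulmxA.
rewrite mul_col_mx mul0mx add_col_mx addr0 mul_row_col mulmxA -/V' -(mulmxA V')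
  -/T.
rewrite -[V' *m T *m C2 *m phi2]mulmxA -[V' *m T *m (C2 *m phi2)]mulmxA
  -mulmxDr -mulmxA.
congr (_ *m _); rewrite -addrA -(mulmxA T c) -mulmxDr mulmxDl -mulmxA.
by rewrite [c *m y + _]addrC mulmxA.
Qed.
End LocalRank.

(** * Noetherian rings *)

Section Noetherian.
Context (R : comPzRingType).
Hypothesis R_noeth : noetherian R.
Implicit Types (I J : set R) (p q : spec R).

Lemma spec_eq p q : (p : set R) = q -> p = q.
Proof.
case: p => I Ip; case: q => J Jp /= IJ; subst J.
by rewrite (Prop_irrelevance Ip Jp).
Qed.

(** A counterexample starts a strictly ascending sequence of ideals; but the generators of its union
    all lie in one term. *)
Lemma noetherian_ind (Q : set R -> Prop) :
  (forall I, is_ideal I -> (forall J, is_ideal J -> I `<` J -> Q J) -> Q I) ->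
  forall I, is_ideal I -> Q I.
Proof.
move=> step I0 I0id; apply: contrapT => nQ0.
have next I : exists J, is_ideal I /\ ~ Q I -> [/\ is_ideal J, ~ Q J & I `<` J].
  have [[Iid nQ]|] := pselect (is_ideal I /\ ~ Q I); last by exists I.
  apply: contrapT => nJ; apply: nQ; apply: step => // J Jid IJ.
  by apply: contrapT => nQJ; apply: nJ; exists J.
have [F FP] := choice next.
pose U k := iter k F I0.
have UP k : is_ideal (U k) /\ ~ Q (U k).
  by elim: k => [//|k /FP[]].
have Ustep k : U k `<` U k.+1 by case: (FP _ (UP k)).
have mono i k : (i <= k)%N -> U i `<=` U k.
  move=> /subnK <-; elim: (k - i)%N => [|l IH]; first exact: subset_refl.
  by apply: subset_trans IH _; case: (Ustep (l + i)%N).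
have Kid : is_ideal (\bigcup_k U k).
  split.
  - by exists 0%N => //; have [[]] := UP 0%N.
  - move=> x y [i _ Ux] [k _ Uy]; exists (i + k)%N => //.
    have [[_ UD _] _] := UP (i + k)%N.
    by apply: UD; [apply: mono Ux|apply: mono Uy]; rewrite ?leq_addr ?leq_addl.
  - move=> a x [i _ Ux]; exists i => //.
    by have [[_ _ UM] _] := UP i; exact: UM.
have [n [g gE]] := R_noeth Kid.
have gK i : exists k, U k (g i).
  have : (\bigcup_k U k) (g i).
    rewrite gE; exists (fun j => (j == i)%:R) => //.
    rewrite (bigD1 i) //= eqxx mul1r big1 ?addr0 // => j ji.
    by rewrite (negPf ji) mul0r.
  by case=> k _ Uk; exists k.
have [k kP] := choice gK.
have [N kN] : exists N, forall i, (k i <= N)%N by exists (\max_i k i) => i;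
  exact: leq_bigmax.
have [_ nsub] := Ustep N; apply: nsub => x Ux.
have : (\bigcup_k U k) x by exists N.+1.
rewrite gE => -[c _ <-]; have [[U0 UD UM] _] := UP N.
elim/big_ind: _ => [//|y z|i _]; first exact: UD.
by apply: UM; exact: mono (kN i) _ (kP i).
Qed.

Lemma maximal_ideal_exists I : is_ideal I -> ~ I 1 ->
  exists J, is_maximal_ideal J /\ I `<=` J.
Proof.
move: I; apply: noetherian_ind => I Iid IH I1.
have [Imax|] := pselect (forall J, is_ideal J -> I `<=` J -> J = I \/ J = setT).
  by exists I; split; [split|exact: subset_refl].
move=> /existsNP[J] /not_implyP[Jid] /not_implyP[IJ] /not_orP[nJI nJT].
have [||K [Kmax JK]] := IH J Jid.
- by split=> // JI; apply: nJI; apply/seteqP.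
- move=> J1; apply: nJT; apply/seteqP; split=> // x _.
  by rewrite -[x]mulr1; have [_ _] := Jid; apply.
- by exists K; split=> //; exact: subset_trans JK.
Qed.

Definition adjoin I x := [set y : R | exists a b, I a /\ y = a + b * x].

Lemma adjoin_ideal I x : is_ideal I -> is_ideal (adjoin I x).
Proof.
move=> [I0 ID IM]; split=> [|_ _ [a [b [Ia ->]]] [c [d [Ic ->]]]|r _ [a [b [Ia
  ->]]]].
- by exists 0, 0; rewrite mul0r addr0.
- by exists (a + c), (b + d); rewrite mulrDl addrACA; split=> //; exact: ID.
- by exists (r * a), (r * b); rewrite mulrDr mulrA; split=> //; exact: IM.
Qed.

Lemma adjoin_sub I x : I `<=` adjoin I x.
Proof. by move=> y Iy; exists y, 0; rewrite mul0r addr0. Qed.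

Lemma adjoin_mem I x : is_ideal I -> adjoin I x x.
Proof. by move=> [I0 _ _]; exists 0, 1; rewrite mul1r add0r. Qed.

Lemma maximal_ideal_prime I : is_maximal_ideal I -> is_prime_ideal I.
Proof.
move=> [Iid I1 Imax]; split=> // x y Ixy; have [I0 ID IM] := Iid.
have [adjI|adjT] := Imax _ (adjoin_ideal x Iid) (@adjoin_sub I x).
  by left; rewrite -adjI; exact: adjoin_mem.
have [a [b [Ia e1]]] : adjoin I x 1 by rewrite adjT.
right; rewrite -[y]mul1r e1 mulrDl; apply: ID; first by rewrite mulrC;
  exact: IM.
by rewrite -mulrA; exact: IM.
Qed.

(** By Noetherian induction on [I], finitely many members of [X] outside [O] are minimal among those
    containing [I]. One may assume that [I] is the intersection of these. If [I] is prime, it lies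
    in [X] by the first hypothesis and outside [O] by the second, so it is the only minimal one.
    Otherwise x y is in [I] with neither factor in [I], and each of them contains I + R x or I + R
    y. *)
Lemma finite_minimal (X O : set (spec R)) :
  (forall p (F : set (spec R)), F `<=` X ->
     (p : set R) = [set x | forall q, F q -> prime_set q x] -> X p) ->
  (forall p, O p -> exists d, ~ prime_set p d /\ forall q,
    ~ prime_set q d -> O q) ->
  exists s : seq (spec R), forall p, X p -> ~ O p ->
    (forall q, X q -> (q : set R) `<=` p -> q <> p -> O q) -> p \in s.
Proof.
move=> Xgeneric Oopen.
pose Q I := exists s : seq (spec R), forall p, X p -> ~ O p -> I `<=` p ->
  (forall q, X q -> ~ O q -> I `<=` q -> (q :
    set R) `<=` p -> q = p) -> p \in s.
suff : Q [set 0].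
  move=> [s sP]; exists s => p Xp Op pmin; apply: sP => //.
    by move=> _ ->; exact: prime0.
  move=> q Xq Oq _ qp; apply: contrapT => qnp; apply: Oq; exact: pmin.
apply: noetherian_ind => [I Iid IH|]; last first.
  by split=> // [_ _ -> ->|a _ ->]; rewrite /= ?addr0 ?mulr0.
have [I0 ID IM] := Iid.
pose I' := [set x : R | forall p, X p -> ~ O p -> I `<=` p -> prime_set p x].
have I'id : is_ideal I'.
  split=> [p _ _ _|x y hx hy p Xp Op Ip|a x hx p Xp Op Ip]; first exact: prime0.
    by apply: primeD; [exact: hx|exact: hy].
  by apply: primeMl; exact: hx.
have II' : I `<=` I' by move=> x Ix p _ _; apply.
have [I'I|I'I] := pselect (I' `<=` I); last first.
  have [s sP] := IH I' I'id (conj II' I'I).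
  exists s => p Xp Op Ip pmin; apply: sP => //; first by move=> x; apply.
  by move=> q Xq Oq I'q; apply: pmin => //; exact: subset_trans I'q.
have [I1|I1] := pselect (I 1).
  by exists [::] => p _ _ Ip _; case: (@nprime1 _ p); exact: Ip.
have [Iprime|] := pselect (forall x y, I (x * y) -> I x \/ I y).
  pose P := Spec (And3 Iid I1 Iprime : is_prime_ideal I).
  pose F := [set p | [/\ X p, ~ O p & I `<=` p]].
  have XP : X P.
    apply: (Xgeneric P F) => [p []//|]; apply/seteqP; split=> x /=.
      by move=> Ix q [_ _]; apply.
    by move=> Fx; apply: I'I => p Xp Op Ip; exact: Fx.
  have OP : ~ O P.
    move=> /Oopen[d [Pd dO]]; apply: Pd; apply: I'I => p Xp Op Ip.
    by apply: contrapT => /dO.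
  exists [:: P] => p Xp Op Ip pmin; rewrite inE; apply/eqP/esym.
  exact: pmin.
move=> /existsNP[x] /existsNP[y] /not_implyP[Ixy] /not_orP[Ix Iy].
have adj z : ~ I z -> exists s : seq (spec R), forall p,
  X p -> ~ O p -> adjoin I z `<=` p ->
    (forall q, X q -> ~ O q -> adjoin I z `<=` q -> (q :
      set R) `<=` p -> q = p) -> p \in s.
  move=> Iz; apply: IH; first exact: adjoin_ideal.
  by split; [exact: adjoin_sub|move=> /(_ z (adjoin_mem z Iid))].
have [[sx sxP] [sy syP]] := (adj x Ix, adj y Iy).
have adjp p z : I `<=` p -> prime_set p z -> adjoin I z `<=` p.
  by move=> Ip pz _ [a [b [Ia ->]]]; apply: primeD; [exact: Ip|exact: primeMl].
exists (sx ++ sy) => p Xp Op Ip pmin; rewrite mem_cat.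
have [_ _ /(_ x y (Ip _ Ixy))[px|py]] := prime_setP p.
  apply/orP; left; apply: sxP => //; first exact: adjp.
  move=> q Xq Oq adjq; apply: pmin => //.
  by apply: subset_trans adjq; exact: adjoin_sub.
apply/orP; right; apply: syP => //; first exact: adjp.
move=> q Xq Oq adjq; apply: pmin => //.
by apply: subset_trans adjq; exact: adjoin_sub.
Qed.

Section Submodules.
Context (V : lmodType R).

Definition submodule (W : set V) :=
  [/\ W 0, forall x y, W x -> W y -> W (x + y) & forall a x, W x -> W (a *: x)].

Definition fg_submodule (W : set V) := exists (T : finType) (g : T -> V),
  (forall i, W (g i)) /\ forall w, W w -> exists c : T -> R,
    w = \sum_i c i *: g i.

Lemma submoduleB W x y : submodule W -> W x -> W y -> W (x - y).
Proof. by move=> [_ WD WZ] Wx Wy; apply: WD => //; rewrite -scaleN1r;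
  exact: WZ. Qed.

Lemma submodule_sum W (I : Type) (s : seq I) (F : I -> V) :
  submodule W -> (forall i, W (F i)) -> W (\sum_(i <- s) F i).
Proof. by move=> [W0 WD _] WF; elim/big_ind: _. Qed.

(** [I] is the ideal of coefficients of [e ord0] in elements of [W]. Lifts of its generators,
    together with generators of the part [W'] spanned without [e ord0], generate [W]. *)
Lemma noetherian_submodule_span n (e : 'I_n -> V) (W : set V) : submodule W ->
  (forall w, W w -> exists c : 'I_n -> R, w =
    \sum_i c i *: e i) -> fg_submodule W.
Proof.
elim: n e W => [|n IH] e W Wsub We.
  exists void, (fun x : void => match x with end); split; first by case.
  by move=> w /We[c ->]; exists (fun=> 0); rewrite big_ord0 big_pred0 //; case.
have [W0 WD WZ] := Wsub.
pose e' i := e (lift ord0 i).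
pose I := [set a | exists w (c : 'I_n -> R),
  W w /\ w = a *: e ord0 + \sum_i c i *: e' i].
have Iid : is_ideal I.
  split.
  - exists 0, (fun=> 0); split=> //; rewrite scale0r add0r big1 // => i _.
    by rewrite scale0r.
  - move=> a b [w [c [Ww wE]]] [v [d [Wv vE]]]; rewrite wE in Ww;
    rewrite vE in Wv.
    eexists; exists (fun i => c i + d i); split; last by [].
    rewrite scalerDl (eq_bigr (fun i => c i *: e' i + d i *: e' i)); last first.
      by move=> i _; rewrite scalerDl.
    by rewrite big_split addrACA; exact: WD.
  - move=> a b [w [c [Ww wE]]]; rewrite wE in Ww.
    eexists; exists (fun i => a * c i); split; last by [].
    rewrite -scalerA (eq_bigr (fun i => a *: (c i *: e' i))); last first.
      by move=> i _; rewrite scalerA.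
    by rewrite -scaler_sumr -scalerDr; exact: WZ.
have [q [a aE]] := R_noeth Iid.
have aI i : I (a i).
  rewrite aE; exists (fun j => (j == i)%:R) => //.
  rewrite (bigD1 i) //= eqxx mul1r big1 ?addr0 // => j ji.
  by rewrite (negPf ji) mul0r.
have [w wP] := choice aI.
pose W' := W `&` [set v | exists c : 'I_n -> R, v = \sum_i c i *: e' i].
have W'sub : submodule W'.
  split.
  - by split=> //; exists (fun=> 0); rewrite big1 // => i _; rewrite scale0r.
  - move=> x y [Wx [c xE]] [Wy [d yE]]; split; first exact: WD.
    exists (fun i => c i + d i); rewrite xE yE -big_split.
    by apply: eq_bigr => i _; rewrite scalerDl.
  - move=> b x [Wx [c xE]]; split; first exact: WZ.
    exists (fun i => b * c i); rewrite xE scaler_sumr.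
    by apply: eq_bigr => i _; rewrite scalerA.
have [|T [g [Wg gP]]] := IH e' W' W'sub; first by move=> v [].
exists ('I_q + T)%type, (fun t => match t with inl i => w i | inr t =>
  g t end); split.
  by case=> [i|t]; [case: (wP i) => c []|case: (Wg t)].
move=> v Wv; have [c vE] := We v Wv; rewrite big_ord_recl in vE.
have : I (c ord0) by exists v, (fun i => c (lift ord0 i)).
rewrite aE => -[b _ cE].
have : W' (v - \sum_i b i *: w i).
  split; first by apply: submoduleB => //; apply: submodule_sum => // i;
    apply: WZ; case: (wP i) => d [].
  have [d dP] := choice wP.
  exists (fun k => c (lift ord0 k) - \sum_i b i * d i k).
  have -> : \sum_i b i *: w i =
      c ord0 *: e ord0 + \sum_k (\sum_i b i * d i k) *: e' k.
    under eq_bigr => i _ do rewrite (dP i).2 scalerDr scalerA.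
    rewrite big_split -scaler_suml cE; congr (_ + _).
    under eq_bigr do rewrite scaler_sumr.
    rewrite exchange_big; apply: eq_bigr => k _; rewrite scaler_suml.
    by apply: eq_bigr => i _; rewrite scalerA.
  rewrite vE opprD addrACA subrr add0r -sumrB.
  by apply: eq_bigr => k _; rewrite scalerBl.
move=> /gP[d dE]; exists (fun t => match t with inl i => b i | inr t =>
  d t end).
by rewrite big_sumType /= -dE addrC subrK.
Qed.

End Submodules.
End Noetherian.

Section Avoidance.
Context (R : comPzRingType).
Implicit Types (p q : spec R) (l : seq (spec R)).

Lemma minimal_prime_in l : l != [::] ->
  exists2 p, p \in l & forall q, q \in l -> (q : set R) `<=` p -> q = p.
Proof.
elim: l => // x [|y l] IH _.
  by exists x; rewrite ?mem_head // => q; rewrite inE => /eqP.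
have [//|p pl pmin] := IH.
have [xp|xp] := pselect ((x : set R) `<=` p); last first.
  exists p => [|q]; first by rewrite inE pl orbT.
  by rewrite inE => /predU1P[->//|]; exact: pmin.
exists x => [|q]; first exact: mem_head.
rewrite inE => /predU1P[->//|ql] qx.
have qp : q = p by apply: pmin => //; exact: subset_trans xp.
by apply/spec_eq/seteqP; split=> //; rewrite qp.
Qed.

Lemma prime_avoid p l : (forall q, q \in l -> ~ (q : set R) `<=` p) ->
  exists r, ~ prime_set p r /\ forall q, q \in l -> prime_set q r.
Proof.
elim: l => [|x l IH] lp; first by exists 1; split=> //; exact: nprime1.
have [|r [pr rl]] := IH; first by move=> q ql; apply: lp; rewrite inE ql orbT.
have /existsNP[a /not_implyP[xa pa]] := lp x (mem_head _ _).
exists (a * r); split=> [|q]; first exact: nprimeM.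
rewrite inE => /predU1P[->|ql]; first exact: primeMr.
by apply: primeMl; exact: rl.
Qed.
End Avoidance.

(** * Removing rows while keeping the local ranks *)

Section SelectRows.
Context (R : comPzRingType) (A : algebra R).
Hypothesis R_noeth : noetherian R.
Hypothesis A_fin : fin_gen (algmod A).
Local Notation iota := (alg_map A).
Implicit Types p q : spec R.

Lemma rank_at_shear p u v (y : 'M[A]_(1, v)) (phi : 'M[A]_(u,
  v)) (a : 'M[A]_(u, 1)) s :
  rank_at p (col_mx y phi) s -> rank_at p (col_mx y (phi + a *m y)) s.
Proof.
have <- : block_mx 1%:M 0 (- a) 1%:M *m col_mx y (phi + a *m y) = col_mx y phi.
  by rewrite mul_block_col !mul1mx mul0mx addr0 mulNmx addrC addrK.
exact: rank_atMl.
Qed.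

(** A minimal prime [p] of the list contains no other one, so some [r] outside [p] lies in all the
    others. The correction needed at [p] may be multiplied by [r], and then [rank_at_congr]
    preserves the ranks obtained at the others. *)
Lemma rank_at_reduce_seq u v (y : 'M[A]_(1, v)) (phi : 'M[A]_(u, v))
    (s : spec R -> nat) (l : seq (spec R)) : uniq l ->
  (forall p, p \in l -> (s p <= u)%N /\ rank_at p (col_mx y phi) (s p)) ->
  exists a : 'M[A]_(u, 1), forall p, p \in l -> rank_at p (phi + a *m y) (s p).
Proof.
have [n] := ubnP (size l); elim: n l => // n IH l ltn lU lP.
have [->|l0] := eqVneq l [::]; first by exists 0.
have [p pl pmin] := minimal_prime_in l0.
have [| |a aP] := IH (rem p l) _ (rem_uniq p lU).
- rewrite size_rem // -ltnS (leq_trans _ ltn) //.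
  by case: (l) l0.
- by move=> q /mem_rem/lP.
have [|r [pr rl]] := @prime_avoid _ p (rem p l).
  move=> q; rewrite mem_rem_uniq // inE => /andP[/eqP qp ql] sub.
  by apply: qp; exact: pmin.
have [sp rp] := lP p pl.
have [z zP] := rank_at_reduce A_fin sp (rank_at_shear a rp).
exists (a + (iota r)%:M *m z) => q ql.
rewrite mulmxDl addrA; have [->|qp] := eqVneq q p; first exact: zP.
have qrem : q \in rem p l by rewrite mem_rem_uniq // inE qp.
by rewrite -mulmxA; apply: rank_at_congr => //; [exact: rl|exact: aP].
Qed.

(** In the application, [X] is the support within the j-spectrum and [D] is the function p |->
    dim_X(p). *)
Context (X : set (spec R)) (D : spec R -> nat).
Hypothesis X_generic : forall p (F : set (spec R)), F `<=` X ->
  (p : set R) = [set x | forall q, F q -> prime_set q x] -> X p.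
Hypothesis D_decr : forall p q, X p -> X q -> (p : set R) `<=` q -> p <> q ->
  (D q < D p)%N.

Lemma rank_at_remove_row t u v (y : 'M[A]_(1, v)) (phi : 'M[A]_(u,
  v)) : (t <= u)%N ->
  (forall p, X p -> rank_at p (col_mx y phi) (minn u.+1 (t + D p))) ->
  exists a : 'M[A]_(u, 1), forall p, X p ->
    rank_at p (phi + a *m y) (minn u (t + D p)).
Proof.
move=> tu rankP.
pose O s := [set p | rank_at p (col_mx y phi) s.+1].
have fin s : exists l : seq (spec R), forall p, X p -> ~ O s p ->
    (forall q, X q -> (q : set R) `<=` p -> q <> p -> O s q) -> p \in l.
  apply: finite_minimal => // p Op.
  by have [d [pd dO]] := rank_at_open Op; exists d.
have [l lP] := choice fin.
(* [bad] is a finite list containing every prime at which the removal could cost too much. Only the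
   values t + D p up to [u] matter, so finitely many lists [l s] are concatenated. *)
pose good p := (t + D p <= u)%N && `[< X p >].
pose bad := undup [seq p <- flatten [seq l s | s <- seq.iota 0 u.+1] | good p].
have [|p|a aP] := @rank_at_reduce_seq u v y phi (fun p => t + D p)%N bad.
- exact: undup_uniq.
- rewrite mem_undup mem_filter => /andP[/andP[Dp /asboolP Xp] _]; split=> //.
  by have := rankP p Xp; rewrite (minn_idPr (leq_trans Dp (leqnSn u))).
exists a => p Xp.
have drop s : rank_at p (col_mx y phi) s.+1 -> rank_at p (phi + a *m y) s.
  by move=> /(rank_at_shear a)/rank_at_drop; exact.
have [Dp|Dp] := leqP (t + D p) u; last first.
  apply: drop.
  by have := rankP p Xp; rewrite (minn_idPl Dp).
have [Op|Op] := pselect (O (t + D p)%N p); first exact: drop.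
apply: aP; rewrite mem_undup mem_filter; apply/andP; split.
  by apply/andP; split=> //; exact/asboolP.
apply/flattenP; exists (l (t + D p)%N).
  by apply: map_f; rewrite mem_iota ltnS.
(* A strictly smaller [q] in [X] has D q > D p, so its rank exceeds t + D p: thus [p] is minimal
   outside O (t + D p). *)
apply: lP => // q Xq qp qnp; apply: rank_at_le (rankP q Xq).
rewrite leq_min ltnS Dp /= -addnS leq_add2l.
exact: D_decr.
Qed.

(** One row is removed for each unit of [k]; truncating the required rank at the number of rows
    makes it exactly [t] when k = 0. *)
Lemma select_rows_ge t k v (phi : 'M[A]_(k + t, v)) :
  (forall p, X p -> rank_at p phi (minn (k + t) (t + D p))) ->
  exists T : 'M[A]_(t, k + t), forall p, X p -> rank_at p (T *m phi) t.
Proof.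
elim: k phi => [|k IH] phi rankP.
  exists 1%:M => p Xp; rewrite mul1mx.
  by have := rankP p Xp; rewrite (minn_idPl (leq_addr _ _)).
pose phi' : 'M_(1 + (k + t), v) := phi.
have phiE : col_mx (usubmx phi') (dsubmx phi') = phi := vsubmxK phi'.
have [|a aP] := @rank_at_remove_row t (k + t) v (usubmx phi') (dsubmx phi')
  (leq_addl _ _).
  by move=> p Xp; rewrite phiE; exact: rankP.
have [T TP] := IH _ aP.
pose T' : 'M_(k + t, 1 + (k + t)) := row_mx a 1%:M.
exists (T *m T') => p Xp; have := TP p Xp; congr rank_at.
transitivity (T *m (T' *m col_mx (usubmx phi') (dsubmx phi'))).
  by rewrite mul_row_col mul1mx addrC.
by rewrite phiE mulmxA.
Qed.

Theorem select_rows t n v (phi : 'M[A]_(n, v)) :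
  (forall p, X p -> rank_at p phi (t + D p)) ->
  exists T : 'M[A]_(t, n), forall p, X p -> rank_at p (T *m phi) t.
Proof.
move=> rankP; have [tn|nt] := leqP t n; last first.
  (* With fewer than [t] rows, pad by zero rows: the padding has a left inverse, so no rank is
     lost. *)
  exists (pid_mx n) => p Xp; apply: (@rank_atMl _ _ _ _ n _ (pid_mx n)).
  rewrite mulmxA pid_mx_id ?(ltnW nt) // pid_mx_1 mul1mx.
  by apply: rank_at_le (rankP p Xp); rewrite leq_addr.
move: phi rankP; rewrite -(subnK tn) => phi rankP.
apply: select_rows_ge => p Xp; apply: rank_at_le (rankP p Xp).
exact: geq_minr.
Qed.

End SelectRows.

(** * Homomorphisms and their localization *)

Section Hom.
Context (R : comPzRingType) (S : algebra R).
Implicit Types U V W : lmodType S^c.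

Record hom U V := Hom { hom_fun :> U -> V; hom_linear : linear hom_fun }.

HB.instance Definition _ U V := gen_eqMixin (hom U V).
HB.instance Definition _ U V := gen_choiceMixin (hom U V).

Lemma hom_eq U V (f g : hom U V) : (forall x, f x = g x) -> f = g.
Proof.
case: f => f fl; case: g => g gl /= fg; have {}fg : f = g by apply/funext.
by subst g; rewrite (Prop_irrelevance fl gl).
Qed.

Section HomZmodule.
Context (U V : lmodType S^c).
Implicit Types f g h : hom U V.

Lemma homD f x y : f (x + y) = f x + f y.
Proof. by have := hom_linear f 1 x y; rewrite !scale1r. Qed.

Lemma homZ f (a : S^c) x : f (a *: x) = a *: f x.
Proof.
have f0 : f 0 = 0 by apply: (addrI (f 0)); rewrite -homD !addr0.
by have := hom_linear f a x 0; rewrite f0 !addr0.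
Qed.

Lemma hom0 f : f 0 = 0.
Proof. by rewrite -[in LHS](scale0r (0 : U)) homZ scale0r. Qed.

Lemma hom_sum f (I : Type) (s : seq I) (F : I -> U) :
  f (\sum_(i <- s) F i) = \sum_(i <- s) f (F i).
Proof. exact: (big_morph f (homD f) (hom0 f)). Qed.

Lemma zero_linear : linear (fun _ : U => 0 : V).
Proof. by move=> a x y; rewrite scaler0 addr0. Qed.

Lemma opp_linear f : linear (fun x => - f x).
Proof. by move=> a x y; rewrite hom_linear opprD scalerN. Qed.

Lemma add_linear f g : linear (fun x => f x + g x).
Proof. by move=> a x y; rewrite !hom_linear scalerDr addrACA. Qed.

Definition hom_zero := Hom zero_linear.
Definition hom_opp f := Hom (opp_linear f).
Definition hom_add f g := Hom (add_linear f g).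

Lemma hom_addA : associative hom_add.
Proof. by move=> f g h; apply: hom_eq => x; exact: addrA. Qed.
Lemma hom_addC : commutative hom_add.
Proof. by move=> f g; apply: hom_eq => x; exact: addrC. Qed.
Lemma hom_add0 : left_id hom_zero hom_add.
Proof. by move=> f; apply: hom_eq => x; exact: add0r. Qed.
Lemma hom_addN : left_inverse hom_zero hom_opp hom_add.
Proof. by move=> f; apply: hom_eq => x; exact: addNr. Qed.

HB.instance Definition _ := GRing.isZmodule.Build (hom U V)
  hom_addA hom_addC hom_add0 hom_addN.

Lemma alg_scalerC r (a : S^c) (x : V) :
  a *: (r *: (x : restr V) : V) = r *: (a *: x : restr V).
Proof.
transitivity ((a * (alg_map S r : S^c)) *: x); first by rewrite -scalerA.
transitivity (((alg_map S r : S^c) * a) *: x); last by rewrite -scalerA.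
by congr (_ *: x); exact: alg_mapC.
Qed.

Lemma hom_scale_linear r f : linear (fun x => r *: (f x : restr V) : V).
Proof.
move=> a x y; rewrite hom_linear alg_scalerC.
exact: (@scalerDr R (restr V)).
Qed.

Definition hom_scale r f := Hom (hom_scale_linear r f).

Lemma hom_scaleA a b f : hom_scale a (hom_scale b f) = hom_scale (a * b) f.
Proof. by apply: hom_eq => x; exact: (@scalerA R (restr V)). Qed.
Lemma hom_scale1 : left_id 1 hom_scale.
Proof. by move=> f; apply: hom_eq => x; exact: (@scale1r R (restr V)). Qed.
Lemma hom_scaleDr : right_distributive hom_scale +%R.
Proof. by move=> a f g; apply: hom_eq => x; exact: (@scalerDr R (restr V)). Qed.
Lemma hom_scaleDl f : {morph hom_scale^~ f : a b / a + b}.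
Proof. by move=> a b; apply: hom_eq => x; exact: (@scalerDl R (restr V)). Qed.

HB.instance Definition _ := GRing.Zmodule_isLmodule.Build R (hom U V)
  hom_scaleA hom_scale1 hom_scaleDr hom_scaleDl.

Lemma hom_sumE (I : Type) (s : seq I) (F : I -> hom U V) x :
  (\sum_(i <- s) F i) x = \sum_(i <- s) F i x.
Proof. by elim/big_rec2: _ => // i y f _ <-. Qed.

Lemma homZr f r (x : restr U) : f (r *: x) = r *: (f x : restr V).
Proof. exact: homZ. Qed.

End HomZmodule.

Lemma comp_linear U V W (f : hom V W) (g : hom U V) : linear (fun x => f (g x)).
Proof. by move=> a x y; rewrite !hom_linear. Qed.

Definition hom_comp U V W (f : hom V W) (g : hom U V) : hom U W :=
  Hom (comp_linear f g).

Lemma id_linear U : linear (fun x : U => x).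
Proof. by []. Qed.

Section Endomorphisms.
Context (N : lmodType S^c).

Definition end_mul : hom N N -> hom N N -> hom N N := @hom_comp N N N.

Lemma end_mulA : associative end_mul.
Proof. by move=> f g h; apply: hom_eq. Qed.
Lemma end_mul1 : left_id (Hom (@id_linear N)) end_mul.
Proof. by move=> f; apply: hom_eq. Qed.
Lemma end_1mul : right_id (Hom (@id_linear N)) end_mul.
Proof. by move=> f; apply: hom_eq. Qed.
Lemma end_mulDl : left_distributive end_mul +%R.
Proof. by move=> f g h; apply: hom_eq. Qed.
Lemma end_mulDr : right_distributive end_mul +%R.
Proof. by move=> f g h; apply: hom_eq => x; exact: homD. Qed.

HB.instance Definition _ := GRing.Zmodule_isPzRing.Build (hom N N)
  end_mulA end_mul1 end_1mul end_mulDl end_mulDr.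

Definition end_scalar (r : R) : hom N N := r *: (1 : hom N N).

Lemma end_scalarB : {morph end_scalar : a b / a - b}.
Proof. by move=> a b; exact: scalerBl. Qed.

Lemma end_scalar_monoid : monoid_morphism end_scalar.
Proof.
split; first exact: scale1r.
by move=> a b; apply: hom_eq => x; rewrite /end_scalar -scalerA.
Qed.

HB.instance Definition _ := GRing.isZmodMorphism.Build R (hom N N) end_scalar
  end_scalarB.
HB.instance Definition _ := GRing.isMonoidMorphism.Build R (hom N N) end_scalar
  end_scalar_monoid.

Lemma end_scalarC r (f : hom N N) : end_scalar r * f = f * end_scalar r.
Proof. by apply: hom_eq => x; exact/esym/homZr. Qed.

Definition end_alg : algebra R := Algebra end_scalarC.

End Endomorphisms.
End Hom.

Section FiniteGeneration.
Context (R : comPzRingType) (S : algebra R).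
Hypothesis R_noeth : noetherian R.
Hypothesis S_fin : fin_gen (algmod S).
Implicit Types U V : lmodType S^c.

Lemma noetherian_submodule (V : lmodType R) (W : set V) :
  fin_gen V -> submodule W -> fg_submodule W.
Proof. by move=> [n [e eP]] Wsub; exact: (noetherian_submodule_span R_noeth
  Wsub). Qed.

Lemma restr_fin V : fin_gen V -> fin_gen (restr V).
Proof.
move=> [n [g gP]]; have [m [e eP]] := S_fin.
apply: (@fin_gen_finite _ _ _ (fun ij : 'I_n * 'I_m =>
  ((e ij.2 : S^c) *: g ij.1 : restr V))) => v.
have [a ->] := gP v; have [c cP] := choice (fun i => eP (a i)).
exists (fun ij => c ij.1 ij.2).
rewrite -(pair_bigA _ (fun i j => c i j *: ((e j : S^c) *: g i : restr V))) /=.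
apply: eq_bigr => i _; transitivity ((\sum_j (c i j *: e j : S^c)) *: g i).
  by rewrite -cP.
rewrite scaler_suml; apply: eq_bigr => j _.
transitivity (((alg_map S (c i j) : S^c) * (e j : S^c)) *: g i);
  last by rewrite -scalerA.
by congr (_ *: g i); exact: alg_mapC.
Qed.

Lemma ffun_fin (V : lmodType R) K : fin_gen V -> fin_gen {ffun 'I_K -> V}.
Proof.
move=> [n [g gP]].
pose E (x : 'I_K * 'I_n) : {ffun 'I_K -> V} := [ffun k =>
  if k == x.1 then g x.2 else 0].
apply: (@fin_gen_finite _ _ _ E) => v.
have [c cP] := choice (fun k => gP (v k)).
exists (fun x => c x.1 x.2); apply/ffunP => k.
rewrite -(pair_bigA _ (fun i j => c i j *: E (i,
  j))) /= sum_ffunE (bigD1 k) //=.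
rewrite [X in _ + X]big1 => [|i ik].
  by rewrite addr0 sum_ffunE cP; apply: eq_bigr => j _; rewrite !ffunE eqxx.
by rewrite sum_ffunE big1 // => j _; rewrite !ffunE eq_sym (negPf ik) scaler0.
Qed.

(** Evaluation at generators of [U] embeds the homomorphisms as an R-submodule of a power of [V],
    where Noetherianity applies. *)
Lemma hom_fin U V : fin_gen U -> fin_gen V -> fin_gen (hom U V).
Proof.
move=> [K [u uP]] Vfin.
pose ev (f : hom U V) : {ffun 'I_K -> restr V} := [ffun k => f (u k)].
have [||T [g [gev gP]]] := @noetherian_submodule {ffun 'I_K -> restr V} [set ev
  f | f in setT].
- exact/ffun_fin/restr_fin.
- split.
  + by exists 0 => //; apply/ffunP => k; rewrite !ffunE.
  + move=> _ _ [f _ <-] [h _ <-]; exists (f + h) => //.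
    by apply/ffunP => k; rewrite !ffunE.
  + move=> a _ [f _ <-]; exists (a *: f) => //.
    by apply/ffunP => k; rewrite !ffunE.
have gev' t : exists f, ev f = g t by have [f _ fg] := gev t; exists f.
have [h hP] := choice gev'.
apply: (@fin_gen_finite _ _ _ h) => f.
have [|c cP] := gP (ev f); first by exists f.
exists c; apply: hom_eq => x; have [a ->] := uP x.
rewrite !hom_sum; apply: eq_bigr => k _; rewrite !homZ; congr (_ *: _).
have := congr1 (fun F : {ffun 'I_K -> restr V} => F k) cP.
rewrite /ev ffunE sum_ffunE => ->; rewrite hom_sumE; apply: eq_bigr => t _.
by rewrite -hP !ffunE.
Qed.

Lemma end_alg_fin V : fin_gen V -> fin_gen (algmod (end_alg V)).
Proof.
move=> Vfin; have [n [g gP]] := hom_fin Vfin Vfin.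
exists n, g => f; have [c ->] := gP f; exists c.
by apply: eq_bigr => i _; apply: hom_eq.
Qed.

End FiniteGeneration.

(** * Lifting homomorphisms between localized modules *)

Section Localize.
Context (R : comPzRingType) (S : algebra R) (p : spec R).
Hypothesis R_noeth : noetherian R.
Hypothesis S_fin : fin_gen (algmod S).
Local Notation out d := (~ prime_set p d).

Lemma common_denominator (T : finType) (P : T -> R -> Prop) :
  (forall i d r, out r -> P i d -> P i (r * d)) ->
  (forall i, exists d, out d /\ P i d) -> exists d, out d /\ forall i, P i d.
Proof.
move=> PM /choice[d dP].
exists (\prod_i d i); split; first by apply: nprime_prod => i; case: (dP i).
move=> i; rewrite (bigD1 i) //= mulrC; apply: PM; last by case: (dP i).
by rewrite big_seq_cond -big_filter; apply: nprime_prod => j; case: (dP j).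
Qed.

Section Module.
Context (V : lmodType S^c).

Definition loc_of (x : V) : loc_mod p V := mod_frac x (denom1 p).

Definition loc_scalar (a : S) : (loc_alg S p)^c := alg_frac a (denom1 p).
Local Notation sc d := (loc_scalar (alg_map S d)).

Lemma loc_ofZ (a : S^c) x : loc_of (a *: x) = loc_scalar a *: loc_of x.
Proof.
transitivity (mod_frac (a *: x) (denomM (denom1 p) (denom1 p))).
  by apply: mod_frac_eq; rewrite //= mul1r.
exact/esym/(loc_mod_scaleE (a : S)).
Qed.

Lemma loc_ofD x y : loc_of (x + y) = loc_of x + loc_of y.
Proof. exact/esym/(@fracDr R p (restr V)). Qed.

Lemma loc_of0 : loc_of 0 = 0.
Proof. by apply: (addrI (loc_of 0)); rewrite -loc_ofD !addr0. Qed.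

Lemma loc_of_sum (I : Type) (s : seq I) (F : I -> V) :
  loc_of (\sum_(i <- s) F i) = \sum_(i <- s) loc_of (F i).
Proof. exact: (big_morph _ loc_ofD loc_of0). Qed.

Lemma loc_of_eq0 x : loc_of x = 0 -> exists u, out u /\ u *: (x : restr V) = 0.
Proof.
rewrite -[0](@frac0 R p (restr V) (denom1 p)) => /frac_eq[u].
by rewrite /= !scale1r scaler0 => ux; exists (dval u); split=> //;
  exact: denomP.
Qed.

Lemma loc_modP (z : loc_mod p V) : exists d (x : V),
  out d /\ sc d *: z = loc_of x.
Proof.
elim/mod_frac_ind: z => x s; exists (dval s), x; split; first exact: denomP.
apply: (etrans (loc_mod_scaleE _ _ _ _)).
apply/frac_eq; exists (denom1 p); rewrite /= !mul1r; congr (_ *: _).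
by rewrite scale1r.
Qed.

Lemma loc_scalarM d r (z : loc_mod p V) : sc (r * d) *: z = sc r *: (sc d *: z).
Proof.
rewrite scalerA; congr (_ *: _); rewrite [RHS]alg_fracM.
by apply: alg_frac_eq; rewrite /= ?mulr1 // -rmorphM mulrC.
Qed.

End Module.

Local Notation sc d := (loc_scalar (alg_map S d)).

Lemma loc_scalarC d (a : S) : sc d * loc_scalar a = loc_scalar a * sc d.
Proof.
rewrite [LHS]alg_fracM [RHS]alg_fracM; apply: alg_frac_eq => //.
exact/esym/alg_mapC.
Qed.

Section Combinations.
Context (K : nat) (W : lmodType S^c) (w : 'I_K -> W).

(** The map out of the free right [S]-module of rank [K]; its source is viewed over [R] so that its
    kernel, the relations between the [w k], is finitely generated. *)
Definition combination (c : {ffun 'I_K -> algmod S}) : W :=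
  \sum_k (c k : S^c) *: w k.

Lemma combinationD c c' : combination (c + c') = combination c + combination c'.
Proof.
rewrite -big_split; apply: eq_bigr => k _; rewrite ffunE.
exact: (@scalerDl S^c W).
Qed.

Lemma combinationZ r c : combination (r *: c) = r *: (combination c : restr W).
Proof.
rewrite scaler_sumr; apply: eq_bigr => k _; rewrite ffunE.
transitivity (((alg_map S r : S^c) * (c k : S^c)) *: w k);
  last by rewrite -scalerA.
by congr (_ *: w k); exact: alg_mapC.
Qed.

Lemma combination0 : combination 0 = 0.
Proof. by rewrite -(scale0r (0 : {ffun 'I_K -> algmod S})) combinationZ
  scale0r. Qed.

Lemma combination_sum (T : finType) (F : T -> {ffun 'I_K -> algmod S}) :
  combination (\sum_t F t) = \sum_t combination (F t).
Proof. exact: (big_morph _ combinationD combination0). Qed.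

End Combinations.

(** A common denominator makes the values of [F] on generators of [U] integral;
    a further one kills the finitely many relations between the generators. *)
Lemma hom_lift (U V : lmodType S^c) (F : U -> loc_mod p V) : fin_gen U ->
  (forall x y, F (x + y) = F x + F y) ->
  (forall (a : S^c) x, F (a *: x) = loc_scalar a *: F x) ->
  exists d, out d /\ exists f : hom U V, forall x, loc_of (f x) = sc d *: F x.
Proof.
move=> [K [u uP]] FD FZ.
have F0 : F 0 = 0 by apply: (addrI (F 0)); rewrite -FD !addr0.
have Fsum (I : Type) (s : seq I) (G : I -> U) :
  F (\sum_(i <- s) G i) = \sum_(i <- s) F (G i).
  exact: (big_morph _ FD F0).
have [d0 [pd0 /choice[m mP]]] : exists d, out d /\
    forall k, exists x : V, sc d *: F (u k) = loc_of x.
  apply: common_denominator => [k d r _ [x dx]|k].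
    by exists ((alg_map S r : S^c) *: x); rewrite loc_scalarM dx loc_ofZ.
  by have [d [x [pd dx]]] := loc_modP (F (u k)); exists d; split=> //; exists x.
pose M := combination m.
have ME c : loc_of (M c) = sc d0 *: F (combination u c).
  rewrite loc_of_sum Fsum scaler_sumr; apply: eq_bigr => k _.
  by rewrite loc_ofZ FZ -mP !scalerA loc_scalarC.
pose rel := [set c | combination u c = 0].
have [||T [g [grel gP]]] := @noetherian_submodule R R_noeth {ffun 'I_K ->
  algmod S} rel.
- exact: ffun_fin.
- split=> [|c c' /= hc hc'|a c /= hc]; first exact: combination0.
    by rewrite /rel /= combinationD hc hc' addr0.
  by rewrite /rel /= combinationZ hc; exact: (@scaler0 R (restr U)).
have [d1 [pd1 d1P]] : exists d, out d /\ forall t, d *: (M (g t) : restr V) = 0.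
  apply: common_denominator => [t d r _ dx|t].
    by rewrite -scalerA dx scaler0.
  by apply: loc_of_eq0; rewrite ME grel F0 scaler0.
have relM c : rel c -> d1 *: (M c : restr V) = 0.
  move=> /gP[b ->]; rewrite /M combination_sum scaler_sumr big1 // => t _.
  by rewrite combinationZ scalerA mulrC -scalerA d1P scaler0.
have exco x : exists c, x = combination u c.
  have [a ->] := uP x; exists [ffun k => (a k : algmod S)].
  by apply: eq_bigr => k _; rewrite ffunE.
have [co coP] := choice exco.
pose f (x : U) : V := d1 *: (M (co x) : restr V).
(* Two expressions of [x] differ by a relation, on which d1 M vanishes; so the choice of [co] is
   immaterial. *)
have fE x c : x = combination u c -> f x = d1 *: (M c : restr V).
  move=> xc; rewrite /f -[co x](subrK c) /M combinationD scalerDr.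
  rewrite -[RHS]add0r; congr (_ + _); apply: relM.
  rewrite /rel /= combinationD -scaleN1r combinationZ -coP -xc.
  by rewrite (@scaleN1r R (restr U)); exact: (@subrr (restr U)).
have flin : linear f.
  move=> a x y; rewrite (@fE _ ([ffun k => ((co x k : S) * a :
    algmod S)] + co y)).
    rewrite /M combinationD (@scalerDr R (restr V)); congr (_ + _).
    rewrite [RHS]alg_scalerC; congr (_ *: _).
    rewrite [RHS]scaler_sumr; apply: eq_bigr => k _; rewrite ffunE.
    by rewrite scalerA.
  rewrite combinationD -coP; congr (_ + _); rewrite [in LHS](coP x) scaler_sumr.
  by apply: eq_bigr => k _; rewrite ffunE scalerA.
exists (d1 * d0); split; first exact: nprimeM.
exists (Hom flin) => x /=; rewrite loc_scalarM.
transitivity (sc d1 *: loc_of (M (co x))); first exact: loc_ofZ.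
by rewrite ME -coP.
Qed.

End Localize.

Section LocalSplitting.
Context (R : comPzRingType) (S : algebra R) (p : spec R) (M N : lmodType S^c).
Hypothesis R_noeth : noetherian R.
Hypothesis S_fin : fin_gen (algmod S).
Hypothesis M_fin : fin_gen M.
Hypothesis N_fin : fin_gen N.
Local Notation out d := (~ prime_set p d).
Local Notation sc d := (loc_scalar p (alg_map S d)).

(** One scalar suffices, namely a common multiple of those killing the values on the finitely many
    generators. *)
Lemma kill_hom (h : hom N N) : (forall x, loc_of p (h x) = 0) ->
  exists u, out u /\ u *: h = 0.
Proof.
move=> h0; have [n [g gP]] := N_fin.
have [u [pu uP]] : exists u, out u /\ forall k : 'I_n,
  u *: (h (g k) : restr N) = 0.
  apply: common_denominator => [k d r _ dx|k]; last exact: loc_of_eq0.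
  by rewrite -scalerA dx scaler0.
exists u; split=> //; apply: hom_eq => x; have [c ->] := gP x.
rewrite hom_sum big1 // => k _.
by rewrite homZ [X in _ *: X]uP; exact: scaler0.
Qed.

(** The coordinates of [F] and the restrictions of [G] to the summands lift after multiplication by
    [d] and [e]. Their composites have the expected values only after localization; a further scalar
    [u] makes this exact and is absorbed into the [f i]. *)
Lemma local_splitting s (F : {linear loc_mod p M -> {ffun 'I_s -> loc_mod p N}})
    (G : {linear {ffun 'I_s -> loc_mod p N} -> loc_mod p M}) : cancel G F ->
  exists d, out d /\ exists (f : 'I_s -> hom M N) (g : 'I_s -> hom N M),
    forall i j, hom_comp (f i) (g j) = (d *+ (i == j)) *: (1 : hom N N).
Proof.
move=> GF.
have [d [pd /choice[f fP]]] : exists d, out d /\ forall i, exists f : hom M N,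
    forall x, loc_of p (f x) = sc d *: F (loc_of p x) i.
  apply: common_denominator => [i d r _ [f fP]|i].
    by exists (r *: f) => x; rewrite loc_scalarM -fP -loc_ofZ.
  apply: hom_lift => // [x y|a x]; first by rewrite loc_ofD linearD ffunE.
  by rewrite loc_ofZ linearZ ffunE.
pose delta j (y : loc_mod p N) : {ffun 'I_s -> loc_mod p N} := [ffun i =>
  if i == j then y else 0].
have [e [pe /choice[g gP]]] : exists e, out e /\ forall j, exists g : hom N M,
    forall x, loc_of p (g x) = sc e *: G (delta j (loc_of p x)).
  apply: common_denominator => [j d' r _ [g gP]|j].
    by exists (r *: g) => x; rewrite loc_scalarM -gP -loc_ofZ.
  apply: hom_lift => // [x y|a x].
    rewrite -linearD; congr (G _); apply/ffunP => i; rewrite !ffunE loc_ofD.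
    by case: eqP => _ //; rewrite addr0.
  rewrite -linearZ; congr (G _); apply/ffunP => i; rewrite !ffunE loc_ofZ.
  by case: eqP => _ //; rewrite scaler0.
have [u [pu uP]] : exists u, out u /\ forall ij : 'I_s * 'I_s,
    u *: (hom_comp (f ij.1) (g ij.2) - (d * e *+ (ij.1 == ij.2)) *: (1 :
      hom N N)) = 0.
  apply: common_denominator => [ij a r _ dx|[i j]];
    first by rewrite -scalerA dx scaler0.
  apply: kill_hom => x.
  transitivity (loc_of p (f i (g j x)) - loc_of p ((d * e *+ (i == j)) *: (x :
    restr N))).
    by apply/eqP; rewrite eq_sym subr_eq -loc_ofD subrK.
  rewrite fP gP linearZ GF /= !ffunE; have [_|_] := eqVneq i j.
    by rewrite mulr1n -loc_scalarM loc_ofZ subrr.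
  by rewrite !scaler0 mulr0n scale0r sub0r loc_of0 oppr0.
exists (u * (d * e)); split; first by do 2 apply: nprimeM => //.
exists (fun i => u *: f i), g => i j.
have /eqP := uP (i, j); rewrite scalerBr subr_eq0 => /eqP /= uE.
transitivity (u *: hom_comp (f i) (g j)); first by apply: hom_eq.
by rewrite uE scalerA mulrnAr.
Qed.

End LocalSplitting.

Section Bilinear.
Context (R : comPzRingType) (S : algebra R) (U V W : lmodType S^c).

Lemma hom_comp_suml (I : Type) (s : seq I) (F : I -> hom V W) (h : hom U V) :
  hom_comp (\sum_(i <- s) F i) h = \sum_(i <- s) hom_comp (F i) h.
Proof. by apply: hom_eq => x; rewrite [RHS]hom_sumE /= hom_sumE. Qed.

Lemma hom_comp_sumr (I : Type) (s : seq I) (F : I -> hom U V) (h : hom V W) :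
  hom_comp h (\sum_(i <- s) F i) = \sum_(i <- s) hom_comp h (F i).
Proof. by apply: hom_eq => x; rewrite /= !hom_sumE hom_sum. Qed.

End Bilinear.

Section Compositions.
Context (R : comPzRingType) (S : algebra R) (M N : lmodType S^c).
Hypothesis R_noeth : noetherian R.
Hypothesis S_fin : fin_gen (algmod S).
Hypothesis M_fin : fin_gen M.
Hypothesis N_fin : fin_gen N.
Local Notation out p d := (~ prime_set p d).
Implicit Types p : spec R.

Context (m n : nat) (f : 'I_m -> hom M N) (g : 'I_n -> hom N M).

Definition comp_mx : 'M[end_alg N]_(m, n) :=
  \matrix_(i, j) hom_comp (f i) (g j).

Lemma comp_mx_rank p s (f' : 'I_s -> hom M N) (g' : 'I_s -> hom N M) d :
  (forall h : hom M N, exists c : 'I_m -> R, h = \sum_i c i *: f i) ->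
  (forall h : hom N M, exists c : 'I_n -> R, h = \sum_i c i *: g i) ->
  out p d ->
  (forall i j, hom_comp (f' i) (g' j) = (d *+ (i == j)) *: (1 : hom N N)) ->
  rank_at p comp_mx s.
Proof.
move=> fP gP pd fg; have [c cP] := choice (fun i => fP (f' i)).
have [b bP] := choice (fun j => gP (g' j)).
exists (\matrix_(i, k) alg_map (end_alg N) (c i k)),
  (\matrix_(l, j) alg_map (end_alg N) (b j l)), d; split=> //.
apply/matrixP => i j; rewrite [RHS]mxE.
transitivity (hom_comp (f' i) (g' j)); last first.
  rewrite fg; case: eqVneq => _; first by rewrite !mulr1n; apply: hom_eq.
  by rewrite !mulr0n scale0r.
rewrite cP bP hom_comp_suml mxE.
under [RHS]eq_bigr do rewrite hom_comp_sumr.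
rewrite exchange_big; apply: eq_bigr => l _; rewrite mxE mulr_suml.
apply: eq_bigr => k _; rewrite !mxE; apply: hom_eq => x.
transitivity (c i k *: (f k (g l (b j l *: (x : restr N))) : restr N));
  first by [].
by rewrite homZr.
Qed.

(** The rows of [T] combine the [f k] into the coordinates of a map to N^t, and the columns of [G]
    combine the [g l] into a section of it. *)
Lemma split_of_comp_mx t (T : 'M[end_alg N]_(t, m)) (G : 'M[end_alg N]_(n, t)) :
  T *m comp_mx *m G = 1%:M ->
  exists F : {linear M -> {ffun 'I_t -> N}}, split_surjective F.
Proof.
move=> TG.
pose f' i := \sum_k hom_comp (T i k : hom N N) (f k).
pose g' j := \sum_l hom_comp (g l) (G l j : hom N N).
have fg i j x : f' i (g' j x) = if i == j then x else 0.
  have : hom_comp (f' i) (g' j) = (T *m comp_mx *m G) i j.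
    rewrite hom_comp_suml mxE; under [LHS]eq_bigr do rewrite hom_comp_sumr.
    rewrite exchange_big; apply: eq_bigr => l _; rewrite mxE mulr_suml.
    by apply: eq_bigr => k _; rewrite !mxE; apply: hom_eq.
  rewrite TG mxE => /(congr1 (fun h : hom N N => h x)) /= ->.
  by case: (i == j).
pose F0 x : {ffun 'I_t -> N} := [ffun i => f' i x].
have F0lin : linear F0.
  by move=> a x y; apply/ffunP => i; rewrite !ffunE hom_linear.
pose F : {linear M -> {ffun 'I_t -> N}} :=
  HB.pack F0 (GRing.isLinear.Build _ _ _ _ F0 F0lin).
pose G0 (y : {ffun 'I_t -> N}) : M := \sum_j g' j (y j).
have G0lin : linear G0.
  move=> a x y; rewrite /G0 scaler_sumr -big_split; apply: eq_bigr => j _.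
  by rewrite !ffunE hom_linear.
pose H : {linear {ffun 'I_t -> N} -> M} :=
  HB.pack G0 (GRing.isLinear.Build _ _ _ _ G0 G0lin).
have HF : cancel H F.
  move=> y; apply/ffunP => i; rewrite ffunE hom_sum (bigD1 i) //= fg eqxx.
  by rewrite big1 ?addr0 // => j ji; rewrite fg eq_sym (negPf ji).
exists F; split; last by exists H.
by move=> y _; exists (H y).
Qed.
End Compositions.

(** * Krull dimension *)

Section Subspaces.
Context (R : comPzRingType).
Implicit Types (X Y : set (spec R)) (E : set R).

Lemma closed_subspec X (Z : set (set_type X)) :
  closed Z <-> exists E, Z = [set x | E `<=` (val x : spec R)].
Proof.
rewrite -[Z in closed Z]setCK closedC; split.
  move=> [_ [E ->] ZE]; exists E.
  by rewrite -[LHS]setCK -ZE preimage_setC setCK.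
move=> [E ->]; exists (~` Var E); first by exists E.
by rewrite preimage_setC.
Qed.

Lemma closed_specialization X (Z : set (set_type X)) (x y : set_type X) :
  closed Z -> Z x -> ((val x : spec R) : set R) `<=` (val y : spec R) -> Z y.
Proof. by move=> /closed_subspec[E ->] /= Ex xy; exact: subset_trans xy. Qed.

(** The direct image under the inclusion of [X] in [Y]; comparing underlying primes avoids a map
    between the two subset types. *)
Definition push X Y (Z : set (set_type X)) : set (set_type Y) :=
  [set y | exists x, Z x /\ val x = val y :> spec R].

Arguments push {X} Y Z.

(** [X] is closed in [Y], so closed sets push forward to closed sets, and closed coverings of an
    image pull back to [X]. *)
Lemma push_chain X Y E n (Z : nat -> set (set_type X)) : X = Var E `&` Y ->
  irreducible_chain n Z -> irreducible_chain n (fun i => push Y (Z i)).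
Proof.
move=> XE [Zirr Zlt].
have XP (q : spec R) : X q -> E `<=` q /\ Y q by rewrite XE.
have EX (q : spec R) : E `<=` q -> Y q -> X q by rewrite XE.
have YX (y : set_type Y) : E `<=` (val y : spec R) -> exists x : set_type X,
  val x = val y :> spec R.
  move=> Ey; have Xy : val y \in X by apply/mem_set/EX => //; exact: set_valP.
  by exists (SigSub Xy).
have XY (x : set_type X) : exists y : set_type Y, val y = val x :> spec R.
  by have [_ /mem_set Yx] := XP _ (set_valP x); exists (SigSub Yx).
have sub (Z1 Z2 : set (set_type X)) : Z1 `<=` Z2 -> push Y Z1 `<=` push Y Z2.
  by move=> Z12 y [x [Zx xy]]; exists x; split=> //; exact: Z12.
split=> i ilt.
  have [Zcl [[x Zx] Zirri]] := Zirr i ilt; split.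
    have /closed_subspec[F ZF] := Zcl; apply/closed_subspec; exists (E `|` F).
    apply/seteqP; split=> y /=.
      move=> [x' [+ xy]]; rewrite ZF -xy /= => Fx r [Er|]; last exact: Fx.
      by have [+ _] := XP _ (set_valP x'); apply.
    move=> EFy; have [|x' xy] := YX y; first by move=> r Er; apply: EFy; left.
    by exists x'; rewrite ZF /= xy; split=> // r Fr; apply: EFy; right.
  split; first by have [y yx] := XY x; exists y, x.
  have pull (C : set (set_type Y)) : closed C ->
      closed [set x : set_type X | exists y, C y /\ val y = val x :> spec R].
    move=> /closed_subspec[F CF]; apply/closed_subspec; exists F.
    apply/seteqP; split=> x' /=; first by move=> [y [+ <-]]; rewrite CF.
    by have [y yx] := XY x'; rewrite -yx => Fy; exists y; rewrite CF.
  move=> A B Acl Bcl ZAB.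
  have pushS C : Z i `<=` [set x : set_type X | exists y,
    C y /\ val y = val x :> spec R] ->
      push Y (Z i) `<=` C.
    by move=> ZC y [x' [/ZC[y' [Cy' y'x]] xy]];
      rewrite -(val_inj (etrans y'x xy)).
  case: (Zirri _ _ (pull A Acl) (pull B Bcl)) => [x' Zx'|ZA|ZB].
  - have [y yx] := XY x'; have [|Ay|By] := ZAB y; first by exists x'.
      by left; exists y.
    by right; exists y.
  - by left; exact: pushS.
  - by right; exact: pushS.
have [Z1 Z2] := Zlt i ilt; split; first exact: sub.
move=> sub'; apply: Z2 => x Zx; have [y yx] := XY x.
have [|x' [Zx' xy]] := sub' y; first by exists x.
by rewrite -(val_inj (etrans xy yx)).
Qed.

Lemma supremum_mem (A : set (\bar int)) x0 :
  A !=set0 -> supremums A (supremum x0 A).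
Proof.
move=> A0; rewrite /supremum; case: eqP => [A_0|_]; last first.
  exact: xgetPex (ereal_int_supremums_neq0 A).
by move: A0; rewrite A_0 => -[].
Qed.

Lemma krull_dim_ge (T : topologicalType) n (Z : nat -> set T) :
  irreducible_chain n Z -> (n%:Z%:E <= krull_dim T)%E.
Proof.
move=> Zn; pose A : set (\bar int) := [set n%:Z%:E | n in [set n | exists Z,
  @irreducible_chain T n Z]].
have An : A n%:Z%:E by exists n => //; exists Z.
by have [ub _] := @supremum_mem A -oo%E (ex_intro _ _ An); exact: ub.
Qed.

Lemma krull_dim_le (T : topologicalType) (b : \bar int) :
  (forall n (Z : nat -> set T), irreducible_chain n Z -> (n%:Z%:E <= b)%E) ->
  (krull_dim T <= b)%E.
Proof.
move=> hb; pose A : set (\bar int) := [set n%:Z%:E | n in [set n | exists Z,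
  @irreducible_chain T n Z]].
have [A0|A0] := pselect (A !=set0).
  have [_ lub] := supremum_mem -oo%E A0; apply: lub => _ [n [Z Zn] <-];
    exact: hb Zn.
have -> : krull_dim T = -oo%E; last exact: leNye.
rewrite /krull_dim /supremum; case: eqP => // nA; case: A0.
by apply/set0P/eqP.
Qed.

Section DimAt.
Context (X : set (spec R)).
Implicit Types p q : spec R.

Lemma irreducible_Var p : X p -> irreducible [set: set_type (Var p `&` X)].
Proof.
move=> Xp; have pP : p \in Var p `&` X by apply/mem_set; split=> //;
  exact: subset_refl.
pose x0 : set_type (Var p `&` X) := SigSub pP.
have gen C : closed C -> C x0 -> setT `<=` C.
  move=> Ccl Cx0 y _; apply: (closed_specialization Ccl Cx0).
  by have [] := set_valP y.
split; first by exists x0.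
move=> A B Acl Bcl /(_ x0 I)[Ax0|Bx0]; [left|right]; exact: gen.
Qed.

Lemma dim_at_ge0 p : X p -> (0 <= dim_at X p)%E.
Proof.
move=> Xp; apply: (@krull_dim_ge _ 0 (fun=> setT)); split=> // i _.
by split; [exact: closedT|exact: irreducible_Var].
Qed.

Lemma dim_at_le p : (dim_at X p <= dim_set X)%E.
Proof.
apply: krull_dim_le => n Z Zn; apply: (@krull_dim_ge _ n (fun i =>
  push X (Z i))).
exact: push_chain Zn.
Qed.

(** A chain in Var q, pushed into Var p, extends by the whole space there. That space is irreducible
    with generic point [p], and [p] does not lie in Var q. *)
Lemma dim_at_lt p q (z : int) : X p -> X q -> (p : set R) `<=` q -> p <> q ->
  (dim_at X p <= z%:E -> dim_at X q <= (z - 1)%:E)%E.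
Proof.
move=> Xp Xq pq pnq dimp; apply: krull_dim_le => k Z Zk.
have VE : Var q `&` X = Var q `&` (Var p `&` X).
  apply/seteqP; split=> r [qr]; last by case.
  by split=> //; split=> //; exact: subset_trans qr.
have [Wirr Wlt] := push_chain VE Zk.
pose W i := if (i <= k)%N then push (Var p `&` X) (Z i) else setT.
suff : irreducible_chain k.+1 W.
  move=> /krull_dim_ge/le_trans/(_ dimp); rewrite !lee_fin; lia.
have pP : p \in Var p `&` X by apply/mem_set; split=> //; exact: subset_refl.
split=> i ik.
  rewrite /W; case: leqP => ik'; first exact: Wirr.
  by split; [exact: closedT|exact: irreducible_Var].
rewrite /W -ltnS ik; move: ik; rewrite ltnS leq_eqVlt => /predU1P[->|ik];
  last first.
  by rewrite ik; exact: Wlt.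
rewrite ltnn; split=> // /(_ (SigSub pP) I)[x [_ /= xp]].
have [qx _] := set_valP x; apply: pnq; apply/spec_eq/seteqP; split=> //.
by rewrite -xp.
Qed.

End DimAt.
End Subspaces.

(** * From local to global *)

Section LocalGlobal.
Context (R : comPzRingType) (S : algebra R) (N : lmodType S^c).
Hypothesis R_noeth : noetherian R.
Hypothesis S_fin : fin_gen (algmod S).
Hypothesis N_fin : fin_gen N.
Local Notation out p d := (~ prime_set p d).
Local Notation A := (end_alg N).
Local Notation iota := (alg_map A).
Local Notation X := (j_spec R `&` Supp N).
Implicit Types p : spec R.

Lemma not_Supp p : ~ Supp N p -> exists d, out p d /\ iota d = 0.
Proof.
move=> nS; have [|u [pu u0]] := @kill_hom R S p N N_fin 1; last by exists u.
move=> x; apply: contrapT => /eqP nx; apply: nS;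
  exists (loc_of p x : loc p (restr N)).
exact: nx.
Qed.

Lemma Supp_nonzero p d : Supp N p -> out p d -> iota d <> 0.
Proof.
move=> [z /eqP z0] pd d0; apply: z0; elim/loc_ind: z => x s.
rewrite -(@frac0 R p (restr N) (denom1 p)); apply/frac_eq; exists (Denom pd).
rewrite /= scaler0 scaler0 scale1r.
exact: (congr1 (fun h : hom N N => h x) d0).
Qed.

(** Pooling the maximal ideals above the members of [F] exhibits [p] in the j-spectrum. If a scalar
    outside [p] killed [N], it would lie outside some [q] in [F], against [q] being in the
    support. *)
Lemma j_Supp_generic p (F : set (spec R)) : F `<=` X ->
  (p : set R) = [set x | forall q, F q -> prime_set q x] -> X p.
Proof.
move=> FX pF; have inp x : (forall q, F q -> prime_set q x) -> prime_set p x.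
  by rewrite -[prime_set p x]/((p : set R) x) pF.
split.
  exists [set I | exists q, F q /\ is_maximal_ideal I /\ (q : set R) `<=` I];
    split.
    by move=> I [q [_ []]].
  apply/seteqP; split=> x.
    by rewrite pF => Fx I [q [/Fx qx [_]]]; apply.
  move=> Ix; apply: inp => q Fq; have [[G [Gmax qG]] _] := FX q Fq.
  rewrite -[prime_set q x]/((q : set R) x) qG => I GI; apply: Ix.
  by exists q; split=> //; split; [exact: Gmax|rewrite qG => y; exact].
apply: contrapT => /not_Supp[d [pd d0]]; apply: pd; apply: inp => q Fq.
apply: contrapT => qd; have [_ Sq] := FX q Fq.
exact: Supp_nonzero Sq qd d0.
Qed.

(** The scalars over which [phi] is right invertible form an ideal. Were it inside a maximal ideal
    [m], then either [m] is outside the support and a scalar outside [m] vanishes in [A], or [m] is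
    in [X] and [rank_at_full] supplies a scalar outside [m]. *)
Lemma local_global t v (phi : 'M[A]_(t, v)) :
  (forall p, X p -> rank_at p phi t) ->
  exists G : 'M[A]_(v, t), phi *m G = 1%:M.
Proof.
move=> rankP; pose I := [set d | exists G : 'M[A]_(v, t),
  phi *m G = (iota d)%:M].
have Iid : is_ideal I.
  split.
  - by exists 0; rewrite mulmx0 rmorph0 raddf0.
  - move=> a b [G GP] [H HP]; exists (G + H).
    by rewrite mulmxDr GP HP rmorphD raddfD.
  - move=> a b [G GP]; exists (G *m (iota a)%:M).
    by rewrite mulmxA GP -scalar_mxM -rmorphM mulrC.
have [[G GP]|I1] := pselect (I 1); first by exists G; rewrite GP rmorph1.
have [J [Jmax IJ]] := maximal_ideal_exists R_noeth Iid I1.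
pose m := Spec (maximal_ideal_prime Jmax).
have outI d : out m d -> ~ I d by move=> md /IJ.
have [Sm|/not_Supp[d [md d0]]] := pselect (Supp N m); last first.
  by case: (outI d md); exists 0; rewrite mulmx0 d0 raddf0.
have Xm : X m.
  split=> //; exists [set J]; split; first by move=> _ ->.
  by rewrite bigcap_set1.
have [G [d [md GP]]] := rank_at_full (end_alg_fin R_noeth S_fin N_fin) (rankP m
  Xm).
by case: (outI d md); exists G.
Qed.

End LocalGlobal.

Section SplSup.
Context (S : pzRingType) (U V : lmodType S^c).

Let A : set (\bar int) := [set t%:Z%:E | t in
  [set t : nat | exists f : {linear U -> {ffun 'I_t -> V}},
    split_surjective f]].

Lemma le_spl t (f : {linear U -> {ffun 'I_t -> V}}) :
  split_surjective f -> (t%:Z%:E <= spl S U V)%E.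
Proof.
move=> fs; have At : A t%:Z%:E by exists t => //; exists f.
by have [ub _] := @supremum_mem A 0%E (ex_intro _ _ At); exact: ub.
Qed.

Lemma spl_ge0 : (0 <= spl S U V)%E.
Proof.
have [[x Ax]|A0] := pselect (A !=set0).
  have [ub _] := @supremum_mem A 0%E (ex_intro _ _ Ax);
    apply: le_trans (ub _ Ax).
  by have [t _ <-] := Ax; rewrite lee_fin.
by rewrite /spl /supremum; case: eqP => // nA; case: A0; apply/set0P/eqP.
Qed.

(** An infinite supremum is not attained, but some admissible [t] exceeds [n] in every case, and
    [rank_at_le] can bring it down. *)
Lemma spl_witness n : (n.+1%:Z%:E <= spl S U V)%E ->
  exists t, (n < t)%N /\ exists f : {linear U -> {ffun 'I_t -> V}},
    split_surjective f.
Proof.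
move=> nspl; apply: contrapT => nt.
have [A0|A0] := pselect (A !=set0).
  have [_ lub] := supremum_mem 0%E A0.
  have : (spl S U V <= n%:Z%:E)%E.
    apply: lub => _ [t [f fs] <-]; rewrite lee_fin lez_nat leqNgt;
      apply/negP => lt_nt.
    by apply: nt; exists t; split=> //; exists f.
  by move=> /(le_trans nspl); rewrite lee_fin lez_nat ltnn.
have : spl S U V = 0%E by rewrite /spl /supremum; case: eqP => // nA; case: A0;
  apply/set0P/eqP.
by move=> spl0; move: nspl; rewrite spl0 lee_fin.
Qed.

End SplSup.

Local Open Scope ereal_scope.

(** * Assembling the bound *)

Section Main.
Context (R : comPzRingType) (S : algebra R) (M N : lmodType S^c).
Hypothesis R_noeth : noetherian R.
Hypothesis S_fin : fin_gen (algmod S).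
Hypothesis M_fin : fin_gen M.
Hypothesis N_fin : fin_gen N.
Local Notation X := (j_spec R `&` Supp N).

Lemma dim_nat : dim_set X < +oo -> exists D : spec R -> nat,
  (forall p, X p -> dim_at X p = (D p)%:Z%:E) /\
  forall p q, X p -> X q -> (p : set R) `<=` q -> p <> q -> (D q < D p)%N.
Proof.
move=> Xfin.
have ex p : exists n : nat, X p -> dim_at X p = n%:Z%:E.
  have [Xp|] := pselect (X p); last by exists 0%N.
  have := dim_at_ge0 Xp; have := le_lt_trans (dim_at_le X p) Xfin.
  by case: (dim_at X p) => [[n|n]||] // _ _; exists n.
have [D DP] := choice ex; exists D; split=> // p q Xp Xq pq pnq.
have := @dim_at_lt R X p q (D p)%:Z Xp Xq pq pnq.
rewrite !DP // => /(_ (lexx _)); rewrite lee_fin; lia.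
Qed.

Lemma splitting_bound (t : nat) (D : spec R -> nat) :
  (forall p q, X p -> X q -> (p : set R) `<=` q -> p <> q -> (D q < D p)%N) ->
  (forall p, X p ->
    (t + D p)%:Z%:E <= spl (loc_alg S p) (loc_mod p M) (loc_mod p N)) ->
  t%:Z%:E <= spl S M N.
Proof.
move=> Ddecr splP.
have [m [f fP]] := hom_fin R_noeth S_fin M_fin N_fin.
have [n [g gP]] := hom_fin R_noeth S_fin N_fin M_fin.
have A_fin := end_alg_fin R_noeth S_fin N_fin.
have rankP p : X p -> rank_at p (comp_mx f g) (t + D p).
  (* Rank at least 0 is witnessed by empty matrices; positive rank needs an actual splitting. *)
  move=> Xp; case: (t + D p)%N (splP p Xp) => [_|s].
    exists 0%R, 0%R, 1%R; split; first exact: nprime1.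
    by apply/matrixP => -[].
  move=> /spl_witness[s' [ss' [F [_ [G GF]]]]].
  have [d [pd [f' [g' fg]]]] := local_splitting R_noeth S_fin M_fin N_fin GF.
  exact: rank_at_le ss' (comp_mx_rank fP gP pd fg).
have [T TP] := select_rows R_noeth A_fin (@j_Supp_generic R S N N_fin) Ddecr
  rankP.
have [G TG] := local_global R_noeth S_fin N_fin TP.
by have [F Fs] := split_of_comp_mx TG; exact: le_spl Fs.
Qed.
End Main.

Lemma infimum_mem (A : set (\bar int)) x0 : A !=set0 -> infimums A (infimum x0
  A).
Proof.
move=> A0; rewrite /infimum; case: eqP => [A_0|_]; last first.
  exact: xgetPex (ereal_int_infimums_neq0 A).
by move: A0; rewrite A_0 => -[].
Qed.

Theorem theorem0p9 (R : comPzRingType) (S : algebra R) (M N : lmodType S^c)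
    (X := j_spec R `&` Supp N) :
  noetherian R ->
  fin_gen (algmod S) -> fin_gen M -> fin_gen N ->
  dim_set X < +oo ->
  infimum +oo [set spl (loc_alg S p) (loc_mod p M) (loc_mod p N) - dim_at X p
                 | p in X]
    <= spl S M N.
Proof.
move=> R_noeth S_fin M_fin N_fin Xfin.
set B := [set _ | _ in X]; set v := infimum _ B.
have [D [DE Ddecr]] := dim_nat Xfin.
have v_le p : X p -> v <= spl (loc_alg S p) (loc_mod p M) (loc_mod p N) -
  dim_at X p.
  move=> Xp; set x := (X in v <= X); have Bx : B x by exists p.
  by have [lb _] := infimum_mem +oo (ex_intro _ _ Bx); exact: lb.
have bound (t : nat) : t%:Z%:E <= v -> t%:Z%:E <= spl S M N.
  move=> tv; apply: (splitting_bound R_noeth S_fin M_fin N_fin Ddecr) => p Xp.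
  have := le_trans tv (v_le p Xp); rewrite DE //.
  by case: (spl _ _ _) => [z||] //=; rewrite !lee_fin; lia.
(* A negative infimum lies below [spl], which is at least 0. The value +oo, which is also the
   default for empty [X], puts every natural number below [spl]. *)
case: v bound v_le => [[n|n]||] bound _.
- exact: bound.
- by apply: le_trans (spl_ge0 M N); rewrite lee_fin.
- case spl_eq: (spl S M N) => [z||] //.
    have := bound `|z|.+1%N (leey _); rewrite spl_eq lee_fin; lia.
  by have := spl_ge0 M N; rewrite spl_eq.
- exact: leNye.
Qed.
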